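(* For every natural number $k \geq 1$, the following principles are pairwise equivalent over $\mathsf{HA}$: (1) $\Sigma_k\text{-}\mathbf{DML} + \Sigma_{k-1}\text{-}\mathbf{DNE}$; (2) $\Sigma_k\text{-}\mathbf{DML}^{\bot}$; (3) $(\Pi_k,\Pi_k)\text{-}\mathbf{CD}$; (4) $\Pi_k\text{-}\mathbf{COLL^{cp}}$; (5) $(\Pi_k \lor \Pi_k)\text{-}\mathbf{DNE}$.
   Context: $\mathsf{HA}$ is first-order intuitionistic (Heyting) arithmetic with connectives $\land,\lor,\to,\exists,\forall,\bot$ ($\neg\varphi$ abbreviates $\varphi\to\bot$), with function symbols for all primitive recursive functions and their defining equations, basic arithmetic axioms, and the full induction scheme. Formulas may contain free variables (parameters). Classes: $\Sigma_0=\Pi_0$ is the set of quantifier-free formulas; $\Sigma_{k+1}=\{\exists x_1\cdots\exists x_n\varphi : \varphi\in\Pi_k,\ n\ge1\}$; $\Pi_{k+1}=\{\forall x_1\cdots\forall x_n\varphi : \varphi\in\Sigma_k,\ n\ge 1\}$. A formula in some $\Sigma_k$ or $\Pi_k$ is in prenex normal form. For sets of formulas, $\Gamma\lor\Theta=\{\varphi\lor\psi:\varphi\in\Gamma,\psi\in\Theta\}$. Dual of a prenex formula: $\varphi^\bot:\equiv\neg\varphi$ for quantifier-free $\varphi$; $(\forall x\varphi)^\bot:\equiv\exists x\,\varphi^\bot$; $(\exists x\varphi)^\bot:\equiv\forall x\,\varphi^\bot$. Principles (schemes): $\Gamma\text{-}\mathbf{DNE}$: $\neg\neg\varphi\to\varphi$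 ($\varphi\in\Gamma$). $\Gamma\text{-}\mathbf{DML}$: $\neg(\varphi\land\psi)\to\neg\varphi\lor\neg\psi$ ($\varphi,\psi\in\Gamma$). $\Gamma\text{-}\mathbf{DML}^\bot$: $\neg(\varphi\land\psi)\to\varphi^\bot\lor\psi^\bot$ ($\varphi,\psi\in\Gamma$). $(\Gamma,\Theta)\text{-}\mathbf{CD}$: $\forall x(\varphi\lor\psi(x))\to\varphi\lor\forall x\,\psi(x)$ ($\varphi\in\Gamma$, $\psi(x)\in\Theta$, $x$ not free in $\varphi$). $\Gamma\text{-}\mathbf{COLL^{cp}}$: $\forall w\,\exists y<x\,\forall z<w\,\varphi(y,z)\to\exists y<x\,\forall z\,\varphi(y,z)$ ($\varphi(y,z)\in\Gamma$, $w$ not free in $\varphi$). For a principle $P$, $\mathsf{HA}+P$ is $\mathsf{HA}$ with the universal closures of all instances of $P$ added as axioms. $P$ and $Q$ (each possibly a sum of principles) are equivalent over $\mathsf{HA}$ if $\mathsf{HA}+P$ proves all instances of $Q$ and $\mathsf{HA}+Q$ proves all instances of $P$. *)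

(* Defs.v *)
From Stdlib Require Fin Vector.
From Stdlib Require Import List.
Import ListNotations.

Set Implicit Arguments.

(** A function symbol for each primitive recursive definition.  [prec]
    recurses on the first argument, and its step [h] takes the predecessor,
    the previous value and the remaining arguments, in this order. *)
Inductive prim : nat -> Set :=
| pzero : prim 0
| psucc : prim 1
| pproj (n : nat) (i : Fin.t n) : prim n
| pcomp (m n : nat) (g : prim m) (hs : Vector.t (prim n) m) : prim n
| prec (n : nat) (g : prim n) (h : prim (S (S n))) : prim (S n).

Inductive term : Set :=
| Var (i : nat)
| App (n : nat) (f : prim n) (ts : Vector.t term n).

(** Variables are de Bruijn indices: [All] and [Ex] bind index [0], and an
    index not below the number of enclosing quantifiers is a parameter. *)
Inductive formula : Set :=
| Bot
| Eq (s t : term)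
| And (A B : formula)
| Or (A B : formula)
| Imp (A B : formula)
| All (A : formula)
| Ex (A : formula).

Definition Neg (A : formula) : formula := Imp A Bot.

Definition zero : term := App pzero (Vector.nil term).
Definition succ (t : term) : term :=
  App psucc (Vector.cons term t 0 (Vector.nil term)).

Fixpoint subst_term (s : nat -> term) (t : term) : term :=
  match t with
  | Var i => s i
  | App f ts => App f (Vector.map (subst_term s) ts)
  end.

Definition shift (i : nat) : term := Var (S i).

Definition up (s : nat -> term) (i : nat) : term :=
  match i with
  | 0 => Var 0
  | S j => subst_term shift (s j)
  end.

Fixpoint subst (s : nat -> term) (A : formula) : formula :=
  match A with
  | Bot => Bot
  | Eq t u => Eq (subst_term s t) (subst_term s u)
  | And B C => And (subst s B) (subst s C)
  | Or B C => Or (subst s B) (subst s C)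
  | Imp B C => Imp (subst s B) (subst s C)
  | All B => All (subst (up s) B)
  | Ex B => Ex (subst (up s) B)
  end.

Definition lift (A : formula) : formula := subst shift A.

(** [inst A t] replaces index [0] by [t] and lowers the other indices. *)
Definition inst (A : formula) (t : term) : formula :=
  subst (fun i => match i with 0 => t | S j => Var j end) A.

Fixpoint term_bound (t : term) : nat :=
  match t with
  | Var i => S i
  | App _ ts => Vector.fold_right (fun u m => Nat.max (term_bound u) m) ts 0
  end.

Fixpoint bound (A : formula) : nat :=
  match A with
  | Bot => 0
  | Eq t u => Nat.max (term_bound t) (term_bound u)
  | And B C | Or B C | Imp B C => Nat.max (bound B) (bound C)
  | All B | Ex B => Nat.pred (bound B)
  end.

(** Quantifies every index below the bound, vacuously for those not free in
    [A]. *)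
Definition closure (A : formula) : formula := Nat.iter (bound A) All A.

(** [T] is meant to be a set of sentences, which is why the quantifier rules
    lift the context [G] only. *)
Inductive prv (T : formula -> Prop) : list formula -> formula -> Prop :=
| prv_ax G A : T A -> prv T G A
| prv_hyp G A : In A G -> prv T G A
| prv_botE G A : prv T G Bot -> prv T G A
| prv_andI G A B : prv T G A -> prv T G B -> prv T G (And A B)
| prv_andE1 G A B : prv T G (And A B) -> prv T G A
| prv_andE2 G A B : prv T G (And A B) -> prv T G B
| prv_orI1 G A B : prv T G A -> prv T G (Or A B)
| prv_orI2 G A B : prv T G B -> prv T G (Or A B)
| prv_orE G A B C :
    prv T G (Or A B) -> prv T (A :: G) C -> prv T (B :: G) C -> prv T G C
| prv_impI G A B : prv T (A :: G) B -> prv T G (Imp A B)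
| prv_impE G A B : prv T G (Imp A B) -> prv T G A -> prv T G B
| prv_allI G A : prv T (map lift G) A -> prv T G (All A)
| prv_allE G A t : prv T G (All A) -> prv T G (inst A t)
| prv_exI G A t : prv T G (inst A t) -> prv T G (Ex A)
| prv_exE G A C :
    prv T G (Ex A) -> prv T (A :: map lift G) (lift C) -> prv T G C.

Inductive HA_axiom : formula -> Prop :=
| HA_refl t : HA_axiom (Eq t t)
| HA_leibniz A s t : HA_axiom (Imp (Eq s t) (Imp (inst A s) (inst A t)))
| HA_succ_nonzero t : HA_axiom (Neg (Eq (succ t) zero))
| HA_succ_inj s t : HA_axiom (Imp (Eq (succ s) (succ t)) (Eq s t))
| HA_proj n (i : Fin.t n) (ts : Vector.t term n) :
    HA_axiom (Eq (App (pproj i) ts) (Vector.nth ts i))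
| HA_comp m n (g : prim m) (hs : Vector.t (prim n) m) (ts : Vector.t term n) :
    HA_axiom (Eq (App (pcomp g hs) ts)
                 (App g (Vector.map (fun h => App h ts) hs)))
| HA_rec_zero n (g : prim n) (h : prim (S (S n))) (ts : Vector.t term n) :
    HA_axiom (Eq (App (prec g h) (Vector.cons term zero n ts)) (App g ts))
| HA_rec_succ n (g : prim n) (h : prim (S (S n))) (u : term)
    (ts : Vector.t term n) :
    HA_axiom
      (Eq (App (prec g h) (Vector.cons term (succ u) n ts))
          (App h (Vector.cons term u _
                   (Vector.cons term
                     (App (prec g h) (Vector.cons term u n ts)) n ts))))
| HA_induction A :
    HA_axiom
      (Imp (inst A zero)
        (Imp (All (Imp A (subst (fun i => match i with
                                          | 0 => succ (Var 0)
                                          | S _ => Var i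
                                          end) A)))
             (All A))).

(** A scheme is the set of its instances, which may have parameters. *)
Definition scheme : Type := formula -> Prop.

Definition plus (P Q : scheme) : scheme := fun A => P A \/ Q A.

Definition HA_plus (P : scheme) : formula -> Prop :=
  fun A => exists B, (HA_axiom B \/ P B) /\ A = closure B.

Definition HA_proves_from (P Q : scheme) : Prop :=
  forall A, Q A -> prv (HA_plus P) [] A.

Definition equivalent_over_HA (P Q : scheme) : Prop :=
  HA_proves_from P Q /\ HA_proves_from Q P.

Fixpoint quantifier_free (A : formula) : Prop :=
  match A with
  | Bot | Eq _ _ => True
  | And B C | Or B C | Imp B C => quantifier_free B /\ quantifier_free C
  | All _ | Ex _ => False
  end.

Fixpoint Sigma (k : nat) (A : formula) : Prop :=
  match k with
  | 0 => quantifier_free A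
  | S j => exists n B, 1 <= n /\ Pi j B /\ A = Nat.iter n Ex B
  end
with Pi (k : nat) (A : formula) : Prop :=
  match k with
  | 0 => quantifier_free A
  | S j => exists n B, 1 <= n /\ Sigma j B /\ A = Nat.iter n All B
  end.

Definition or_class (C D : formula -> Prop) : formula -> Prop :=
  fun A => exists B B', C B /\ D B' /\ A = Or B B'.

(** Only meaningful on prenex formulas, where the last case is reached only
    at the quantifier-free matrix. *)
Fixpoint dual (A : formula) : formula :=
  match A with
  | All B => Ex (dual B)
  | Ex B => All (dual B)
  | _ => Neg A
  end.

Definition ppred : prim 1 := prec pzero (pproj (@Fin.F1 1)).

(** [pmonus_rev] takes [(y, x)] to the truncated difference [x - y]. *)
Definition pmonus_rev : prim 2 :=
  prec (pproj (@Fin.F1 0))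
       (pcomp ppred (Vector.cons _ (pproj (Fin.FS (@Fin.F1 1))) 0
                                 (Vector.nil _))).

(** [s < t] as the atomic formula [(s + 1) - t = 0]. *)
Definition Lt (s t : term) : formula :=
  Eq (App pmonus_rev
        (Vector.cons term t _ (Vector.cons term (succ s) _ (Vector.nil term))))
     zero.

(** The bound [t] lives outside the quantifier. *)
Definition All_lt (t : term) (A : formula) : formula :=
  All (Imp (Lt (Var 0) (subst_term shift t)) A).

Definition Ex_lt (t : term) (A : formula) : formula :=
  Ex (And (Lt (Var 0) (subst_term shift t)) A).

Definition DNE (C : formula -> Prop) : scheme :=
  fun X => exists A, C A /\ X = Imp (Neg (Neg A)) A.

Definition DML (C : formula -> Prop) : scheme :=
  fun X => exists A B, C A /\ C B /\
    X = Imp (Neg (And A B)) (Or (Neg A) (Neg B)).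

Definition DML_dual (C : formula -> Prop) : scheme :=
  fun X => exists A B, C A /\ C B /\
    X = Imp (Neg (And A B)) (Or (dual A) (dual B)).

Definition CD (C D : formula -> Prop) : scheme :=
  fun X => exists A B, C A /\ D B /\
    X = Imp (All (Or (lift A) B)) (Or A (All B)).

(** In [A], index [0] is [z], index [1] is [y] and the others are parameters,
    among which the variable [x] of index [x] outside the quantifiers.  In the
    premise [w] sits between [y] and the parameters, so these are renumbered. *)
Definition COLLcp (C : formula -> Prop) : scheme :=
  fun X => exists (x : nat) (A : formula), C A /\
    X = Imp
          (All (Ex_lt (Var (S x))
                 (All_lt (Var 1) (subst (up (up shift)) A))))
          (Ex_lt (Var x) (All A)).

(* Main.v *)
Require Import Defs.
From Stdlib Require Import List PeanoNat Lia.
From Stdlib Require Fin Vector.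
Import ListNotations.

Set Implicit Arguments.

(** Write [k = j + 1]. Every principle implies the next one in the cycle
    [DML_dual] -> [(Pi_k \/ Pi_k)-DNE] -> [COLLcp] -> [CD] -> [DML_dual], and
    [DML_dual] is interderivable with [DML] plus [Sigma_j]-DNE.

    The steps that involve [DML_dual] rest on three facts about duals of prenex
    formulas: [A] contradicts [dual A]; [dual (dual A)] implies [A], as matrices
    are decidable; and [Sigma_j]-DNE gives [~ A -> dual A] for every [A] in
    [Sigma_k] ([neg_dual]). So over [Sigma_j]-DNE a dual is just a negation.

    From [CD] one first gets excluded middle for [Sigma_j], level by level
    ([or_dual_of_cd]): if [B] is decidable then [Ex x B \/ dual B(x)] holds for
    all [x], and [CD] moves the quantifier onto [dual B]. In the same way, if
    [~ (A /\ Ex z C(z))] with [C] decidable, then [dual A \/ dual C(z)] for all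
    [z], and [CD] concludes ([dml_dual_of_cd]).

    From [COLLcp] to [CD]: if [A \/ B(z)] for all [z], then for each [w] one of
    [A] and [All z < w, B(z)] holds, by induction on [w]. Coding the choice by
    a number [y < 2], collection makes it uniform in [w] ([cd_of_collcp]).

    The long step is from DNE for [Pi_k \/ Pi_k] to [COLLcp]. The premise of
    collection gives [~~ Ex y < x, D(y)] where [D(y)] is [All z, A(y, z)]
    ([not_not_collection]), so it is enough to show that [Ex y < x, D(y)] is
    stable, by induction on [x] ([stable_ex_lt]). The inductive step needs DNE
    for [(Ex y < x, D(y)) \/ D(x)], whose left side is not prenex. But excluded
    middle holds for [Sigma_j], and it makes [D(y)] equivalent to
    [All v, B(v, y)] with [B] in [Sigma_j] and decreasing in [v]; then
    [All v, Ex y < x, B(v, y)] is in [Pi_k] up to equivalence and can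
    replace [Ex y < x, D(y)] under a double negation. What remains is that
    [Sigma_j] is closed under bounded quantifiers up to equivalence
    ([cls_bounded]). For quantifier-free formulas this is a bounded search by a
    primitive recursive function ([qf_ex_lt]); higher up it follows from the
    intuitionistic collection schema, with duality by excluded middle.

    Derivations are built through admissible rules in which object quantifiers
    become quantifiers over terms of the metalanguage ([prv_allI_terms],
    [prv_exE_terms]), so that formal proofs read like informal ones. *)

(** * Substitution *)

Definition scons (t : term) (s : nat -> term) (i : nat) : term :=
  match i with 0 => t | S j => s j end.
Infix ".:" := scons (at level 55, right associativity).

Definition app1 (f : prim 1) (t : term) : term :=
  App f (Vector.cons term t 0 (Vector.nil term)).
Definition app2 (f : prim 2) (s t : term) : term :=
  App f (Vector.cons term s _ (Vector.cons term t 0 (Vector.nil term))).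

Definition monus t s := app2 pmonus_rev t s.

(** The generated principle gives nothing for the arguments of a function
    symbol, which sit in a vector. *)
Fixpoint term_rect_all (R : term -> Prop)
    (HV : forall i, R (Var i))
    (HA : forall n (f : prim n) ts, Vector.Forall R ts -> R (App f ts))
    (t : term) : R t :=
  match t with
  | Var i => HV i
  | App f ts =>
      HA _ f ts ((fix go n (us : Vector.t term n) : Vector.Forall R us :=
        match us with
        | Vector.nil _ => @Vector.Forall_nil _ _
        | Vector.cons _ u _ us' =>
            @Vector.Forall_cons _ _ _ _ _ (term_rect_all HV HA u) (go _ us')
        end) _ ts)
  end.

Lemma subst_term_ext_bound t s r :
  (forall i, i < term_bound t -> s i = r i) -> subst_term s t = subst_term r t.
Proof.
  induction t as [i | n f ts IH] using term_rect_all; cbn; intros H.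
  - apply H; lia.
  - f_equal. clear f. induction IH as [| n u us Hu _ IHus]; cbn in *; [reflexivity|].
    rewrite Hu, IHus; [reflexivity| |]; auto; intros i Hi; apply H; lia.
Qed.

Lemma subst_term_ext t s r :
  (forall i, s i = r i) -> subst_term s t = subst_term r t.
Proof. intros H; apply subst_term_ext_bound; auto. Qed.

Lemma subst_term_comp t s r :
  subst_term s (subst_term r t) = subst_term (fun i => subst_term s (r i)) t.
Proof.
  induction t as [i | n f ts IH] using term_rect_all; cbn; [reflexivity|].
  f_equal. clear f. induction IH as [| n u us Hu _ IHus]; cbn in *; congruence.
Qed.

Lemma subst_term_id t s : (forall i, s i = Var i) -> subst_term s t = t.
Proof.
  intros Hs; induction t as [i | n f ts IH] using term_rect_all; cbn; [apply Hs|].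
  f_equal. clear f. induction IH as [| n u us Hu _ IHus]; cbn in *; congruence.
Qed.

(** Only the free variables matter: the source of the invariance of sentences
    and of the existence of fresh variables. *)
Lemma subst_ext_bound A : forall s r,
  (forall i, i < bound A -> s i = r i) -> subst s A = subst r A.
Proof.
  assert (U : forall B s r, (forall i, i < Nat.pred (bound B) -> s i = r i) ->
                forall i, i < bound B -> up s i = up r i).
  { intros B s r H [|i] Hi; cbn; [reflexivity|]. rewrite H; [reflexivity|lia]. }
  induction A; cbn; intros p q H; f_equal;
    try (apply subst_term_ext_bound; intros; apply H; lia);
    try (apply IHA1; intros; apply H; lia); try (apply IHA2; intros; apply H; lia);
    try reflexivity; apply IHA; apply U; exact H.
Qed.

Lemma subst_ext A s r : (forall i, s i = r i) -> subst s A = subst r A.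
Proof. intros H; apply subst_ext_bound; auto. Qed.

Lemma up_comp s r i :
  subst_term (up s) (up r i) = up (fun j => subst_term s (r j)) i.
Proof. destruct i; cbn; [reflexivity|]. rewrite !subst_term_comp. reflexivity. Qed.

Lemma subst_comp A : forall s r,
  subst s (subst r A) = subst (fun i => subst_term s (r i)) A.
Proof.
  induction A; cbn; intros p q; rewrite ?subst_term_comp; f_equal; auto;
    rewrite ?IHA; apply subst_ext; apply up_comp.
Qed.

Lemma subst_id A : forall s, (forall i, s i = Var i) -> subst s A = A.
Proof.
  induction A; cbn; intros p Hp; f_equal; auto using subst_term_id;
    apply IHA; intros [|i]; cbn; rewrite ?Hp; reflexivity.
Qed.

Definition swap (A : formula) : formula :=
  subst (Var 1 .: Var 0 .: fun i => Var (S (S i))) A.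

(* Substitutions are compared pointwise; those written here differ from a
   renaming of variables at no more than the first few indices. *)
Ltac sbpoint :=
  let i := fresh "i" in
  intros i; do 5 (try destruct i as [|i]); cbn;
  unfold shift; cbn; rewrite ?subst_term_comp; cbn;
  try reflexivity.

Ltac sbterm :=
  unfold monus, app2, app1, succ, zero; cbn; rewrite ?subst_term_comp; cbn;
  lazymatch goal with
  | |- ?x = ?x => reflexivity
  | |- App ?f _ = App ?f _ => f_equal; sbterm
  | |- Vector.cons _ _ _ _ = Vector.cons _ _ _ _ => f_equal; sbterm
  | |- subst_term _ ?t = subst_term _ ?t =>
      apply subst_term_ext; sbpoint; try sbterm
  | |- subst_term _ ?t = ?t => apply subst_term_id; sbpoint
  | |- ?t = subst_term _ ?t => symmetry; apply subst_term_id; sbpoint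
  | |- _ => idtac
  end.

Ltac sbform :=
  lazymatch goal with
  | |- ?x = ?x => reflexivity
  | |- And _ _ = And _ _ => f_equal; sbform
  | |- Or _ _ = Or _ _ => f_equal; sbform
  | |- Imp _ _ = Imp _ _ => f_equal; sbform
  | |- All _ = All _ => f_equal; sbform
  | |- Ex _ = Ex _ => f_equal; sbform
  | |- Eq _ _ = Eq _ _ => f_equal; sbterm
  | |- subst _ ?A = subst _ ?A => apply subst_ext; sbpoint; try sbterm
  | |- subst _ ?A = ?A => apply subst_id; sbpoint; try sbterm
  | |- ?A = subst _ ?A => symmetry; apply subst_id; sbpoint; try sbterm
  | |- _ => repeat f_equal; sbterm
  end.

(** Proves equalities that hold by computing substitutions. *)
Ltac sb :=
  unfold swap, inst, lift, Ex_lt, All_lt, Lt, Neg, scons; cbn [subst];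
  rewrite ?subst_comp; sbform.

Lemma inst_lift A t : inst (lift A) t = A.
Proof. sb. Qed.

(** * Quantifier rules over terms *)

Class sentences (T : formula -> Prop) : Prop :=
  subst_sentence : forall A s, T A -> subst s A = A.

Section Rules.
Context {T : formula -> Prop} {HT : sentences T}.

Lemma prv_weaken G A : prv T G A -> forall G', incl G G' -> prv T G' A.
Proof.
  induction 1; intros G' HG.
  - now apply prv_ax.
  - apply prv_hyp; auto.
  - apply prv_botE; auto.
  - apply prv_andI; auto.
  - eapply prv_andE1; auto.
  - eapply prv_andE2; auto.
  - apply prv_orI1; auto.
  - apply prv_orI2; auto.
  - eapply prv_orE; [apply IHprv1| apply IHprv2 | apply IHprv3]; auto;
      intros x [->|Hx]; [now left|right; auto|now left|right; auto].
  - apply prv_impI; apply IHprv; intros x [->|Hx]; [now left|right; auto].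
  - eapply prv_impE; auto.
  - apply prv_allI; apply IHprv; apply incl_map; exact HG.
  - apply prv_allE; auto.
  - eapply prv_exI; auto.
  - eapply prv_exE; [apply IHprv1; exact HG|apply IHprv2].
    intros x [->|Hx]; [now left|right; revert x Hx; apply incl_map; exact HG].
Qed.

Lemma map_lift_subst G s :
  map (subst (up s)) (map lift G) = map lift (map (subst s) G).
Proof. rewrite !map_map. apply map_ext. intros A. sb. Qed.

Lemma subst_inst A t s :
  subst s (inst A t) = inst (subst (up s) A) (subst_term s t).
Proof. sb. Qed.

Lemma prv_subst G A : prv T G A -> forall s, prv T (map (subst s) G) (subst s A).
Proof.
  induction 1; intros s; cbn in *.
  - rewrite subst_sentence; auto. now apply prv_ax.
  - apply prv_hyp. now apply in_map.
  - apply prv_botE; apply IHprv.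
  - apply prv_andI; auto.
  - eapply prv_andE1; apply IHprv.
  - eapply prv_andE2; apply IHprv.
  - apply prv_orI1; auto.
  - apply prv_orI2; auto.
  - eapply prv_orE; [apply IHprv1| apply IHprv2 | apply IHprv3].
  - apply prv_impI; apply IHprv.
  - eapply prv_impE; [apply IHprv1|apply IHprv2].
  - apply prv_allI. rewrite <- map_lift_subst. apply IHprv.
  - rewrite subst_inst. apply prv_allE. apply IHprv.
  - eapply prv_exI. rewrite <- subst_inst. apply IHprv.
  - eapply prv_exE; [apply IHprv1|]. rewrite <- map_lift_subst.
    replace (lift (subst s C)) with (subst (up s) (lift C)) by sb.
    apply IHprv2.
Qed.

Lemma fresh_for (G : list formula) : exists n, forall A, In A G -> bound A <= n.
Proof.
  induction G as [|A G [n Hn]]; [exists 0; intros _ []|].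
  exists (Nat.max (bound A) n). intros B [->|HB]; [lia|]. specialize (Hn B HB). lia.
Qed.

(** A proof of [inst A t] for one variable [t] fresh for [A] and [G] is enough:
    renaming that variable to index [0] turns it into a premise of [prv_allI].
    Hence a universal formula is proved by a metalevel function on terms. *)
Lemma prv_allI_terms G A : (forall t, prv T G (inst A t)) -> prv T G (All A).
Proof.
  intros H. destruct (fresh_for (All A :: G)) as [n Hn].
  (* [s] undoes the choice of the fresh variable and lifts all others. *)
  pose (s := fun i => if Nat.eqb i n then Var 0 else Var (S i)).
  assert (Hs : forall i, i <> n -> s i = Var (S i)).
  { intros i Hi. unfold s. destruct (Nat.eqb_spec i n); [contradiction|reflexivity]. }
  apply prv_allI.
  replace (map lift G) with (map (subst s) G).
  - replace A with (subst s (inst A (Var n))) at 1; [apply prv_subst, H|].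
    unfold inst. rewrite subst_comp.
    rewrite <- (subst_id A Var) at 2 by reflexivity. apply subst_ext_bound.
    intros [|i] Hi; cbn; [unfold s; rewrite Nat.eqb_refl; reflexivity|].
    apply Hs. specialize (Hn (All A) (or_introl eq_refl)). cbn in Hn. lia.
  - apply map_ext_in. intros B HB. apply subst_ext_bound. intros i Hi.
    apply Hs. specialize (Hn B (or_intror HB)). lia.
Qed.

Lemma prv_exE_terms G A C :
  prv T G (Ex A) -> (forall t, prv T (inst A t :: G) C) -> prv T G C.
Proof.
  intros HA HC.
  assert (H : prv T G (All (Imp A (lift C)))).
  { apply prv_allI_terms. intros t.
    replace (inst (Imp A (lift C)) t) with (Imp (inst A t) C) by sb.
    apply prv_impI, HC. }
  apply (prv_exE _ HA). eapply prv_impE; [|apply prv_hyp; now left].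
  apply prv_weaken with (G := map lift G); [|now apply incl_tl].
  apply prv_subst with (s := shift) in H.
  apply (prv_allE (Var 0)) in H.
  replace (inst _ _) with (Imp A (lift C)) in H; [exact H|]. sb.
Qed.
End Rules.

(** * Equality, induction and a proof mode *)

Class arith (T : formula -> Prop) : Prop := {
  arith_sentences :: sentences T;
  arith_HA : forall G A, HA_axiom A -> prv T G A }.

Lemma prv_cons T G A B : prv T G A -> prv T (B :: G) A.
Proof. intros H; eapply prv_weaken; [exact H|]. now apply incl_tl. Qed.

Lemma prv_head T G A : prv T (A :: G) A.
Proof. apply prv_hyp. now left. Qed.

(** Proves the goal by [H], whose formula agrees with the goal up to the
    computation of substitutions. *)
Ltac conv H :=
  lazymatch type of H with
  | prv ?T ?G ?A => lazymatch goal with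
    | |- prv _ _ ?B => replace B with A; [exact H | try solve [sb]] end end.

(** [pgoal X] and [phyp H X] restate the goal or a hypothesis as [X]. *)
Ltac pgoal X :=
  lazymatch goal with |- prv _ _ ?B => replace B with X; [ | try solve [sb]] end.

Ltac phyp H X :=
  lazymatch type of H with prv ?T ?G ?B =>
    let H' := fresh in
    assert (H' : prv T G X); [conv H | clear H; rename H' into H] end.

(** A hypothesis of the object proof is a Rocq hypothesis [prv T G X]; when the
    context of the goal grows, all of them are weakened. *)
Ltac push :=
  repeat match goal with
  | H : prv ?T ?G ?X |- prv ?T (?A :: ?G) _ => apply (prv_cons A) in H
  end.

(** The rules of natural deduction, naming the new hypothesis. *)
Ltac phead H :=
  push; cbv beta;
  lazymatch goal with |- prv ?T (?A :: ?G) _ =>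
    pose proof (prv_head T G A : prv T (A :: G) A) as H end.

Ltac pintro H :=
  apply prv_impI; phead H.

Ltac por H H1 :=
  apply (prv_orE H); phead H1.

Ltac pall t := apply prv_allI_terms; intros t.

Ltac pex H t H1 :=
  apply (prv_exE_terms H); intros t; phead H1.

Ltac pcut X H :=
  lazymatch goal with |- prv ?T ?G _ => assert (H : prv T G X) end.

Section Arithmetic.
Context {T : formula -> Prop} {HT : arith T}.
Implicit Types (G : list formula) (s t u x y z : term).

Lemma prv_eq_refl G t : prv T G (Eq t t).
Proof. apply arith_HA, HA_refl. Qed.

Lemma prv_leibniz A G s t :
  prv T G (Eq s t) -> prv T G (inst A s) -> prv T G (inst A t).
Proof.
  intros H K. eapply prv_impE; [|exact K]. eapply prv_impE; [|exact H].
  apply arith_HA, HA_leibniz.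
Qed.

(** Leibniz's law under a simultaneous substitution for the other variables. *)
Lemma prv_leibniz_at A r G s t :
  prv T G (Eq s t) -> prv T G (subst (s .: r) A) -> prv T G (subst (t .: r) A).
Proof.
  intros H K.
  pose proof (prv_leibniz (subst (Var 0 .: (fun i => subst_term shift (r i))) A) H) as L.
  pcut (inst (subst (Var 0 .: (fun i => subst_term shift (r i))) A) s) K'.
  { conv K. }
  specialize (L K'). conv L.
Qed.

Lemma prv_eq_sym G s t : prv T G (Eq s t) -> prv T G (Eq t s).
Proof.
  intros H. pose proof (prv_leibniz (Eq (Var 0) (subst_term shift s)) H) as L.
  pcut (inst (Eq (Var 0) (subst_term shift s)) s) K.
  { pgoal (Eq s s). apply prv_eq_refl. }
  specialize (L K). conv L.
Qed.

Lemma prv_eq_trans G s t u :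
  prv T G (Eq s t) -> prv T G (Eq t u) -> prv T G (Eq s u).
Proof.
  intros H K. pose proof (prv_leibniz (Eq (subst_term shift s) (Var 0)) K) as L.
  pcut (inst (Eq (subst_term shift s) (Var 0)) t) J. { conv H. }
  specialize (L J). conv L.
Qed.

(** Leibniz's law replaces one variable; induction on [m] replaces the variables
    below [m] one at a time. *)
Lemma prv_eq_subst_below m G u (s r : nat -> term) :
  (forall i, i < m -> prv T G (Eq (s i) (r i))) ->
  prv T G (Eq (subst_term s u)
              (subst_term (fun i => if i <? m then r i else s i) u)).
Proof.
  induction m as [|m IH]; intros H.
  - replace (subst_term (fun i => if i <? 0 then r i else s i) u)
      with (subst_term s u) by (apply subst_term_ext; reflexivity).
    apply prv_eq_refl.
  - specialize (IH (fun i Hi => H i (Nat.lt_lt_succ_r _ _ Hi))).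
    pose (h := fun i => if i <? m then subst_term shift (r i)
                        else if i =? m then Var 0 else subst_term shift (s i)).
    pose (A := Eq (subst_term shift (subst_term s u)) (subst_term h u)).
    assert (E : forall t, inst A t = Eq (subst_term s u)
      (subst_term (fun i => if i <? m then r i else if i =? m then t else s i) u)).
    { intros t. unfold A, inst; cbn [subst]. rewrite !subst_term_comp. f_equal.
      - apply subst_term_ext; sbpoint; try sbterm.
      - apply subst_term_ext. intros i. unfold h.
        destruct (i <? m), (i =? m); sbterm. }
    pose proof (prv_leibniz A (H m (Nat.lt_succ_diag_r m))) as L.
    rewrite !E in L.
    replace (subst_term (fun i => if i <? S m then r i else s i) u)
      with (subst_term (fun i => if i <? m then r i else if i =? m then r m else s i) u).
    + apply L.
      replace (subst_term (fun i => if i <? m then r i else if i =? m then s m else s i) u)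
        with (subst_term (fun i => if i <? m then r i else s i) u); [exact IH|].
      apply subst_term_ext. intros i. destruct (Nat.eqb_spec i m) as [->|]; reflexivity.
    + apply subst_term_ext. intros i.
      destruct (Nat.eqb_spec i m) as [->|Hi].
      * rewrite Nat.ltb_irrefl. destruct (Nat.ltb_spec m (S m)); [reflexivity|lia].
      * destruct (Nat.ltb_spec i m), (Nat.ltb_spec i (S m)); (reflexivity || lia).
Qed.

Lemma prv_eq_subst G u (s r : nat -> term) :
  (forall i, i < term_bound u -> prv T G (Eq (s i) (r i))) ->
  prv T G (Eq (subst_term s u) (subst_term r u)).
Proof.
  intros H. eapply prv_eq_trans; [apply prv_eq_subst_below, H|].
  rewrite (@subst_term_ext_bound u (fun i => if i <? term_bound u then r i else s i) r);
    [apply prv_eq_refl|].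
  intros i Hi. destruct (Nat.ltb_spec i (term_bound u)); [reflexivity|lia].
Qed.

(** To rewrite inside a term [u], whose variable [0] marks the position. *)
Lemma prv_eq_inside u r G s t :
  prv T G (Eq s t) ->
  prv T G (Eq (subst_term (s .: r) u) (subst_term (t .: r) u)).
Proof.
  intros H. apply prv_eq_subst. intros [|i] _; cbn; [exact H|apply prv_eq_refl].
Qed.

(** [A] is the formula that the induction axiom needs, and [F] its instances in
    simplified form. *)
Lemma prv_induction A F G :
  (forall t, inst A t = F t) ->
  prv T G (F zero) ->
  (forall t, prv T (F t :: G) (F (succ t))) ->
  forall t, prv T G (F t).
Proof.
  intros HF H0 HS t. rewrite <- HF. apply prv_allE.
  eapply prv_impE; [eapply prv_impE; [apply arith_HA, HA_induction|]|].
  - rewrite HF. exact H0.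
  - pall v. pgoal (Imp (inst A v) (inst A (succ v))).
    rewrite !HF. apply prv_impI, HS.
Qed.

Lemma prv_zero_or_succ G t :
  prv T G (Or (Eq t zero) (Ex (Eq (subst_term shift t) (succ (Var 0))))).
Proof.
  revert t.
  apply prv_induction with
    (A := Or (Eq (Var 0) zero) (Ex (Eq (Var 1) (succ (Var 0)))))
    (F := fun t => Or (Eq t zero) (Ex (Eq (subst_term shift t) (succ (Var 0))))).
  - intros t; sb.
  - apply prv_orI1, prv_eq_refl.
  - intros t. apply prv_orI2, prv_exI with t.
    pgoal (Eq (succ t) (succ t)). apply prv_eq_refl.
Qed.

Lemma prv_cases G t A :
  prv T (Eq t zero :: G) A ->
  (forall u, prv T (Eq t (succ u) :: G) A) -> prv T G A.
Proof.
  intros H0 HS. apply (prv_orE (prv_zero_or_succ G t)); [exact H0|].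
  apply (prv_exE_terms (prv_head _ _ _)). intros u.
  apply prv_weaken with (G := Eq t (succ u) :: G); [apply HS|].
  replace (inst _ u) with (Eq t (succ u)) by sb.
  intros B [->|HB]; [now left|right; now right].
Qed.

End Arithmetic.

Ltac pcases s u E := apply (prv_cases (t := s)); [phead E|intros u; phead E].

Notation "↑ t" := (subst_term shift t) (at level 20).

(** * The order relation *)

Section Order.
Context {T : formula -> Prop} {HT : arith T}.
Implicit Types (G : list formula) (s t u x y z : term).

Lemma prv_eq_app1 f G s t :
  prv T G (Eq s t) -> prv T G (Eq (app1 f s) (app1 f t)).
Proof. apply (prv_eq_inside (app1 f (Var 0)) Var). Qed.

Lemma prv_eq_app2 f G s t u v :
  prv T G (Eq s t) -> prv T G (Eq u v) ->
  prv T G (Eq (app2 f s u) (app2 f t v)).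
Proof.
  intros H K. apply prv_eq_trans with (app2 f t u).
  - pose proof (prv_eq_inside (app2 f (Var 0) (Var 1)) (u .: Var) H) as L. exact L.
  - pose proof (prv_eq_inside (app2 f (Var 1) (Var 0)) (t .: Var) K) as L. exact L.
Qed.

Lemma prv_succ_eq G s t : prv T G (Eq s t) -> prv T G (Eq (succ s) (succ t)).
Proof. apply (prv_eq_app1 psucc). Qed.

Lemma prv_succ_zero G t A : prv T G (Eq (succ t) zero) -> prv T G A.
Proof. intros H. apply prv_botE. revert H. apply prv_impE, arith_HA, HA_succ_nonzero. Qed.

Lemma prv_pred_zero G : prv T G (Eq (app1 ppred zero) zero).
Proof. apply arith_HA. exact (HA_rec_zero _ _ (Vector.nil term)). Qed.

Lemma prv_pred_succ G t : prv T G (Eq (app1 ppred (succ t)) t).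
Proof.
  eapply prv_eq_trans; apply arith_HA.
  - exact (HA_rec_succ _ _ t (Vector.nil term)).
  - exact (HA_proj Fin.F1 (Vector.cons term t _ (Vector.cons term _ _ (Vector.nil term)))).
Qed.

Lemma prv_monus_zero G x : prv T G (Eq (monus zero x) x).
Proof.
  eapply prv_eq_trans; apply arith_HA.
  - exact (HA_rec_zero _ _ (Vector.cons term x _ (Vector.nil term))).
  - exact (HA_proj Fin.F1 (Vector.cons term x _ (Vector.nil term))).
Qed.

Lemma prv_monus_succ G t x :
  prv T G (Eq (monus (succ t) x) (app1 ppred (monus t x))).
Proof.
  eapply prv_eq_trans; [apply arith_HA;
    exact (HA_rec_succ _ _ t (Vector.cons term x _ (Vector.nil term)))|].
  eapply prv_eq_trans; [apply arith_HA, HA_comp|].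
  cbn. apply prv_eq_app1, arith_HA.
  exact (HA_proj (Fin.FS Fin.F1) (Vector.cons term _ _ (Vector.cons term _ _
    (Vector.cons term _ _ (Vector.nil term))))).
Qed.

(** [pmonus_rev] recurses on the subtrahend by predecessors; this symmetric
    recursion is what makes [Lt] tractable. *)
Lemma prv_monus_succ_succ G t x :
  prv T G (Eq (monus (succ t) (succ x)) (monus t x)).
Proof.
  revert t. apply prv_induction with
    (F := fun t => Eq (monus (succ t) (succ x)) (monus t x))
    (A := Eq (monus (succ (Var 0)) (succ (↑ x))) (monus (Var 0) (↑ x))).
  - intros t; sb.
  - apply prv_eq_trans with x; [|apply prv_eq_sym, prv_monus_zero].
    eapply prv_eq_trans; [apply prv_monus_succ|].
    eapply prv_eq_trans; [apply prv_eq_app1, prv_monus_zero|apply prv_pred_succ].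
  - intros t. eapply prv_eq_trans; [apply prv_monus_succ|].
    eapply prv_eq_trans; [apply prv_eq_app1, prv_head|].
    apply prv_eq_sym, prv_monus_succ.
Qed.

Lemma prv_monus_by_zero G t : prv T G (Eq (monus t zero) zero).
Proof.
  revert t. apply prv_induction with
    (F := fun t => Eq (monus t zero) zero) (A := Eq (monus (Var 0) zero) zero).
  - intros t; sb.
  - apply prv_monus_zero.
  - intros t. eapply prv_eq_trans; [apply prv_monus_succ|].
    eapply prv_eq_trans; [apply prv_eq_app1, prv_head|apply prv_pred_zero].
Qed.

Lemma prv_lt_zero G t A : prv T G (Lt t zero) -> prv T G A.
Proof.
  intros H. apply prv_succ_zero with t.
  eapply prv_eq_trans; [|exact H]. apply prv_eq_sym, prv_monus_zero.
Qed.

Lemma prv_lt_eq G s s' t t' :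
  prv T G (Eq s s') -> prv T G (Eq t t') -> prv T G (Lt s t) -> prv T G (Lt s' t').
Proof.
  intros Hs Ht H. eapply prv_eq_trans; [|exact H].
  apply (prv_eq_app2 pmonus_rev); apply prv_eq_sym; [exact Ht|].
  apply prv_succ_eq, Hs.
Qed.

Lemma prv_lt_succ_succ G s t :
  prv T G (Lt s t) -> prv T G (Lt (succ s) (succ t)).
Proof. intros H. eapply prv_eq_trans; [apply prv_monus_succ_succ|exact H]. Qed.

Lemma prv_lt_succ_succ_inv G s t :
  prv T G (Lt (succ s) (succ t)) -> prv T G (Lt s t).
Proof.
  intros H. eapply prv_eq_trans; [apply prv_eq_sym, prv_monus_succ_succ|exact H].
Qed.

Lemma prv_zero_lt_succ G t : prv T G (Lt zero (succ t)).
Proof. eapply prv_eq_trans; [apply prv_monus_succ_succ|apply prv_monus_by_zero]. Qed.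

(** The induction on [t] strips a successor from both sides, so it must be
    uniform in [s]. *)
Lemma prv_lt_succ_cases G s t :
  prv T G (Lt s (succ t)) -> prv T G (Or (Lt s t) (Eq s t)).
Proof.
  revert G s.
  assert (H : forall t, prv T []
    (All (Imp (Lt (Var 0) (succ (↑ t))) (Or (Lt (Var 0) (↑ t)) (Eq (Var 0) (↑ t)))))).
  { apply prv_induction with
      (F := fun t => All (Imp (Lt (Var 0) (succ (↑ t)))
                          (Or (Lt (Var 0) (↑ t)) (Eq (Var 0) (↑ t)))))
      (A := All (Imp (Lt (Var 0) (succ (Var 1)))
                  (Or (Lt (Var 0) (Var 1)) (Eq (Var 0) (Var 1))))).
    - intros v; sb.
    - pall s. pgoal (Imp (Lt s (succ zero)) (Or (Lt s zero) (Eq s zero))).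
      pintro H. apply prv_orI2. pcases s u E; [exact E|].
      apply prv_lt_zero with u. apply prv_lt_succ_succ_inv.
      apply prv_lt_eq with s (succ zero); auto using prv_eq_refl.
    - intros v. phead IH. pall s.
      pgoal (Imp (Lt s (succ (succ v))) (Or (Lt s (succ v)) (Eq s (succ v)))).
      pintro H. pcases s u E.
      + apply prv_orI1. apply prv_lt_eq with zero (succ v);
          auto using prv_eq_sym, prv_eq_refl, prv_zero_lt_succ.
      + apply (prv_allE u) in IH. phyp IH (Imp (Lt u (succ v)) (Or (Lt u v) (Eq u v))).
        assert (L := prv_impE IH (prv_lt_succ_succ_inv (prv_lt_eq E (prv_eq_refl _ _) H))).
        por L M.
        * apply prv_orI1. apply prv_lt_succ_succ in M.
          eapply prv_lt_eq; [apply prv_eq_sym, E|apply prv_eq_refl|exact M].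
        * apply prv_orI2. eapply prv_eq_trans; [exact E|]. apply prv_succ_eq, M. }
  intros G s K. specialize (H t). apply (prv_allE s) in H.
  apply prv_weaken with (G' := G) in H; [|intros ? []].
  eapply prv_impE; [|exact K]. conv H.
Qed.
Lemma prv_lt_succ_diag G t : prv T G (Lt t (succ t)).
Proof.
  revert t. apply prv_induction with
    (F := fun t => Lt t (succ t)) (A := Lt (Var 0) (succ (Var 0))).
  - intros t; sb.
  - apply prv_zero_lt_succ.
  - intros t. apply prv_lt_succ_succ, prv_head.
Qed.

Lemma prv_lt_succ G s t : prv T G (Lt s t) -> prv T G (Lt s (succ t)).
Proof.
  intros H. eapply prv_eq_trans; [apply prv_monus_succ|].
  eapply prv_eq_trans; [apply prv_eq_app1, H|apply prv_pred_zero].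
Qed.

Lemma prv_lt_trans G s t u :
  prv T G (Lt s t) -> prv T G (Lt t u) -> prv T G (Lt s u).
Proof.
  intros H. apply prv_impE. revert u. apply prv_induction with
    (F := fun u => Imp (Lt t u) (Lt s u))
    (A := Imp (Lt (↑ t) (Var 0)) (Lt (↑ s) (Var 0))).
  - intros u; sb.
  - pintro K. apply prv_lt_zero with t, K.
  - intros u. phead IH. pintro K. apply prv_lt_succ.
    apply prv_lt_succ_cases in K. por K L.
    + exact (prv_impE IH L).
    + apply prv_lt_eq with s t; auto using prv_eq_refl.
Qed.

Lemma prv_lt_irrefl G t A : prv T G (Lt t t) -> prv T G A.
Proof.
  intros H. apply prv_botE. revert H. apply prv_impE.
  revert t. apply prv_induction with
    (F := fun t => Imp (Lt t t) Bot) (A := Imp (Lt (Var 0) (Var 0)) Bot).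
  - intros t; sb.
  - pintro K. apply prv_lt_zero with zero, K.
  - intros t. phead IH. pintro K. apply (prv_impE IH), prv_lt_succ_succ_inv, K.
Qed.

Lemma prv_lt_trichotomy G s t : prv T G (Or (Or (Lt s t) (Lt t s)) (Eq s t)).
Proof.
  enough (H : forall t, prv T G
      (All (Or (Or (Lt (Var 0) (↑ t)) (Lt (↑ t) (Var 0))) (Eq (Var 0) (↑ t))))).
  { specialize (H t). apply (prv_allE s) in H. conv H. }
  apply prv_induction with
    (F := fun t => All (Or (Or (Lt (Var 0) (↑ t)) (Lt (↑ t) (Var 0))) (Eq (Var 0) (↑ t))))
    (A := All (Or (Or (Lt (Var 0) (Var 1)) (Lt (Var 1) (Var 0))) (Eq (Var 0) (Var 1)))).
  - intros v; sb.
  - pall v. pgoal (Or (Or (Lt v zero) (Lt zero v)) (Eq v zero)). pcases v u E.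
    + apply prv_orI2, E.
    + apply prv_orI1, prv_orI2. apply prv_lt_eq with zero (succ u);
        auto using prv_eq_refl, prv_eq_sym, prv_zero_lt_succ.
  - intros w. phead IH. pall v.
    pgoal (Or (Or (Lt v (succ w)) (Lt (succ w) v)) (Eq v (succ w))). pcases v u E.
    + apply prv_orI1, prv_orI1. apply prv_lt_eq with zero (succ w);
        auto using prv_eq_refl, prv_eq_sym, prv_zero_lt_succ.
    + apply (prv_allE u) in IH. phyp IH (Or (Or (Lt u w) (Lt w u)) (Eq u w)).
      pose proof (prv_eq_sym E) as E'.
      por IH K; [por K L|].
      * apply prv_orI1, prv_orI1. apply prv_lt_eq with (succ u) (succ w);
          auto using prv_eq_refl, prv_lt_succ_succ.
      * apply prv_orI1, prv_orI2. apply prv_lt_eq with (succ w) (succ u);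
          auto using prv_eq_refl, prv_lt_succ_succ.
      * apply prv_orI2. eapply prv_eq_trans; [exact E|apply prv_succ_eq, K].
Qed.

(** Stands in for the maximum when two witnesses have to be bounded at once. *)
Lemma prv_upper_bound G s t A :
  (forall w, prv T (And (Lt s w) (Lt t w) :: G) A) -> prv T G A.
Proof.
  intros H. apply prv_exE_terms with (A := And (Lt (↑ s) (Var 0)) (Lt (↑ t) (Var 0))).
  - assert (C := prv_lt_trichotomy G s t).
    pose proof (prv_lt_succ_diag G s) as Hs.
    pose proof (prv_lt_succ_diag G t) as Ht.
    por C D; [por D E|].
    + apply prv_exI with (succ t). pgoal (And (Lt s (succ t)) (Lt t (succ t))).
      apply prv_andI; auto using prv_lt_succ.
    + apply prv_exI with (succ s). pgoal (And (Lt s (succ s)) (Lt t (succ s))).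
      apply prv_andI; auto using prv_lt_succ.
    + apply prv_exI with (succ t). pgoal (And (Lt s (succ t)) (Lt t (succ t))).
      apply prv_andI; auto.
      apply prv_lt_eq with s (succ s); auto using prv_succ_eq, prv_eq_refl.
  - intros w. replace (inst _ w) with (And (Lt s w) (Lt t w)) by sb. apply H.
Qed.

Lemma prv_all_ltI G t A :
  (forall u, prv T (Lt u t :: G) (inst A u)) -> prv T G (All_lt t A).
Proof.
  intros H. pall u. pgoal (Imp (Lt u t) (inst A u)). apply prv_impI, H.
Qed.

Lemma prv_all_ltE u G t A :
  prv T G (All_lt t A) -> prv T G (Lt u t) -> prv T G (inst A u).
Proof.
  intros H. apply prv_impE. apply (prv_allE u) in H. conv H.
Qed.

Lemma prv_ex_ltI u G t A :
  prv T G (Lt u t) -> prv T G (inst A u) -> prv T G (Ex_lt t A).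
Proof.
  intros H K. apply prv_exI with u. pgoal (And (Lt u t) (inst A u)).
  apply prv_andI; assumption.
Qed.

Lemma prv_ex_ltE G t A C :
  prv T G (Ex_lt t A) ->
  (forall u, prv T (And (Lt u t) (inst A u) :: G) C) -> prv T G C.
Proof.
  intros H K. pex H u L.
  replace (inst _ u) with (And (Lt u t) (inst A u)) by sb. apply K.
Qed.

Lemma prv_eq_dec G s t : prv T G (Or (Eq s t) (Neg (Eq s t))).
Proof.
  assert (C := prv_lt_trichotomy G s t). por C D; [por D E|].
  - apply prv_orI2. pintro K. apply prv_lt_irrefl with t.
    apply prv_lt_eq with s t; auto using prv_eq_refl.
  - apply prv_orI2. pintro K. apply prv_lt_irrefl with t.
    apply prv_lt_eq with t s; auto using prv_eq_refl.
  - apply prv_orI1, D.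
Qed.

Lemma prv_qf_dec A : quantifier_free A -> forall G, prv T G (Or A (Neg A)).
Proof.
  induction A; cbn; intros Q G; try contradiction.
  - apply prv_orI2. pintro H. exact H.
  - apply prv_eq_dec.
  - destruct Q as [Q1 Q2]. specialize (IHA1 Q1 G). specialize (IHA2 Q2 G).
    por IHA1 H1; [por IHA2 H2|].
    + apply prv_orI1, prv_andI; assumption.
    + apply prv_orI2. pintro H. exact (prv_impE H2 (prv_andE2 H)).
    + apply prv_orI2. pintro H. exact (prv_impE H1 (prv_andE1 H)).
  - destruct Q as [Q1 Q2]. specialize (IHA1 Q1 G). specialize (IHA2 Q2 G).
    por IHA1 H1; [|por IHA2 H2].
    + apply prv_orI1, prv_orI1, H1.
    + apply prv_orI1, prv_orI2, H2.
    + apply prv_orI2. pintro H. por H K; [exact (prv_impE H1 K)|exact (prv_impE H2 K)].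
  - destruct Q as [Q1 Q2]. specialize (IHA1 Q1 G). specialize (IHA2 Q2 G).
    por IHA1 H1; [por IHA2 H2|].
    + apply prv_orI1. pintro K. exact H2.
    + apply prv_orI2. pintro K. exact (prv_impE H2 (prv_impE K H1)).
    + apply prv_orI1. pintro K. apply prv_botE. exact (prv_impE H1 K).
Qed.
End Order.

Ltac pexlt H u H1 H2 :=
  apply (prv_ex_ltE H); intros u; phead H1;
  pose proof (prv_andE2 H1) as H2; apply prv_andE1 in H1.

Ltac palllt u H := apply prv_all_ltI; intros u; phead H.

(** Holding in every context amounts to the provability of both implications. *)
Definition equiv (T : formula -> Prop) (A B : formula) : Prop :=
  forall G, prv T G A <-> prv T G B.

(** * Bounded search by primitive recursion *)

Fixpoint env n (us : Vector.t term n) : nat -> term :=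
  match us with
  | Vector.nil _ => fun _ => zero
  | Vector.cons _ u _ us' => u .: env us'
  end.

Fixpoint vars n : Vector.t term n :=
  match n with
  | 0 => Vector.nil term
  | S m => Vector.cons term (Var 0) m (Vector.map (subst_term shift) (vars m))
  end.

(** The function symbol of [n] arguments that computes [t] as a function of its
    first [n] variables. Since [env] sends the other variables to [zero], the
    specification [prv_prim_of_term] holds for all terms. *)
Fixpoint prim_of_term n (t : term) : prim n :=
  match t with
  | Var i => match Compare_dec.lt_dec i n with
             | left h => pproj (Fin.of_nat_lt h)
             | right _ => pcomp pzero (Vector.nil _)
             end
  | App f ts => pcomp f (Vector.map (prim_of_term n) ts)
  end.

Definition prim_rec n (b s : term) : prim (S n) :=
  prec (prim_of_term n b) (prim_of_term (S (S n)) s).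

Lemma nth_env n (us : Vector.t term n) : forall i (h : i < n),
  Vector.nth us (Fin.of_nat_lt h) = env us i.
Proof.
  induction us as [|u n us IH]; intros [|i] h; cbn; try lia; [reflexivity|apply IH].
Qed.

Lemma env_over n (us : Vector.t term n) i : n <= i -> env us i = zero.
Proof.
  revert i. induction us as [|u n us IH]; intros [|i] h; cbn; try lia; try reflexivity.
  apply IH; lia.
Qed.

Lemma map_env_vars n (us : Vector.t term n) :
  Vector.map (subst_term (env us)) (vars n) = us.
Proof.
  induction us as [|u n us IH]; cbn; [reflexivity|]. f_equal.
  rewrite Vector.map_map. etransitivity; [|exact IH]. apply Vector.map_ext.
  intros t. rewrite subst_term_comp. reflexivity.
Qed.

Lemma env_vars n i : i < n -> env (vars n) i = Var i.
Proof.
  assert (M : forall m (us : Vector.t term m) j, j < m ->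
    env (Vector.map (subst_term shift) us) j = ↑ (env us j)).
  { induction us as [|u m us IH]; intros [|j] Hj; cbn; try lia; [reflexivity|].
    apply IH; lia. }
  revert i; induction n as [|n IH]; intros [|i] Hi; cbn; try lia; [reflexivity|].
  rewrite M, IH by lia. reflexivity.
Qed.

Section Recursion.
Context {T : formula -> Prop} {HT : arith T}.
Implicit Types (G : list formula) (s t u x y z : term).

Lemma prv_eq_app n (f : prim n) G (us vs : Vector.t term n) :
  Vector.Forall2 (fun s t => prv T G (Eq s t)) us vs ->
  prv T G (Eq (App f us) (App f vs)).
Proof.
  intros H.
  pose proof (@prv_eq_subst T HT G (App f (vars n)) (env us) (env vs)) as K.
  cbn in K. rewrite !map_env_vars in K. apply K. intros i _. clear K f.
  revert i. induction H as [|m s t ss ts Hst _ IH]; intros [|i]; cbn;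
    auto using prv_eq_refl.
Qed.

Lemma prv_prim_of_term n t G (us : Vector.t term n) :
  prv T G (Eq (App (prim_of_term n t) us) (subst_term (env us) t)).
Proof.
  induction t as [i|m f ts IH] using term_rect_all; cbn.
  - destruct (Compare_dec.lt_dec i n) as [h|h].
    + rewrite <- (nth_env us h). apply arith_HA, HA_proj.
    + rewrite env_over by lia. apply arith_HA.
      exact (HA_comp pzero (Vector.nil _) us).
  - eapply prv_eq_trans; [apply arith_HA, HA_comp|]. apply prv_eq_app. clear f.
    induction IH; cbn; constructor; auto.
Qed.

Lemma prv_prim_rec_zero n b s G (us : Vector.t term n) :
  prv T G (Eq (App (prim_rec n b s) (Vector.cons term zero _ us))
              (subst_term (env us) b)).
Proof. eapply prv_eq_trans; [apply arith_HA, HA_rec_zero|apply prv_prim_of_term]. Qed.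

Lemma prv_prim_rec_succ n b s u G (us : Vector.t term n) :
  prv T G (Eq (App (prim_rec n b s) (Vector.cons term (succ u) _ us))
    (subst_term (u .: App (prim_rec n b s) (Vector.cons term u _ us) .: env us) s)).
Proof. eapply prv_eq_trans; [apply arith_HA, HA_rec_succ|apply prv_prim_of_term]. Qed.

Definition one := succ zero.
(** Truth is coded by [zero]. Recursion on the first argument, which is a case
    distinction here, selects the second argument or a constant. *)
Definition prim_or := prim_rec 1 zero (Var 2).
Definition prim_and := prim_rec 1 (Var 0) one.
Definition prim_imp := prim_rec 1 (Var 0) zero.

Lemma prv_rec1_zero b s a c G :
  prv T G (Eq a zero) ->
  prv T G (Eq (app2 (prim_rec 1 b s) a c) (subst_term (c .: fun _ => zero) b)).
Proof.
  intros H. eapply prv_eq_trans; [apply prv_eq_app2; [exact H|apply prv_eq_refl]|].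
  apply prv_prim_rec_zero.
Qed.

Lemma prv_rec1_succ b s a u c G :
  prv T G (Eq a (succ u)) ->
  prv T G (Eq (app2 (prim_rec 1 b s) a c)
    (subst_term (u .: app2 (prim_rec 1 b s) u c .: c .: fun _ => zero) s)).
Proof.
  intros H. eapply prv_eq_trans; [apply prv_eq_app2; [exact H|apply prv_eq_refl]|].
  apply prv_prim_rec_succ.
Qed.

Lemma equiv_prim_or a c :
  equiv T (Eq (app2 prim_or a c) zero) (Or (Eq a zero) (Eq c zero)).
Proof.
  intros G; split; intros H.
  - pcases a u E; [apply prv_orI1, E|]. apply prv_orI2.
    eapply prv_eq_trans; [|exact H].
    apply prv_eq_sym, (prv_rec1_succ zero (Var 2) c E).
  - pcases a u E.
    + exact (prv_rec1_zero zero (Var 2) c E).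
    + eapply prv_eq_trans; [exact (prv_rec1_succ zero (Var 2) c E)|].
      cbn. por H K; [|exact K]. apply prv_succ_zero with u.
      eapply prv_eq_trans; [apply prv_eq_sym, E|exact K].
Qed.

Lemma equiv_prim_and a c :
  equiv T (Eq (app2 prim_and a c) zero) (And (Eq a zero) (Eq c zero)).
Proof.
  intros G; split; intros H.
  - pcases a u E.
    + apply prv_andI; [exact E|]. eapply prv_eq_trans; [|exact H].
      apply prv_eq_sym, (prv_rec1_zero (Var 0) one c E).
    + apply prv_succ_zero with zero. eapply prv_eq_trans; [|exact H].
      apply prv_eq_sym, (prv_rec1_succ (Var 0) one c E).
  - eapply prv_eq_trans; [exact (prv_rec1_zero (Var 0) one c (prv_andE1 H))|].
    exact (prv_andE2 H).
Qed.

Lemma equiv_prim_imp a c :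
  equiv T (Eq (app2 prim_imp a c) zero) (Imp (Eq a zero) (Eq c zero)).
Proof.
  intros G; split; intros H.
  - pintro K. eapply prv_eq_trans; [|exact H].
    apply prv_eq_sym. exact (prv_rec1_zero (Var 0) zero c K).
  - pcases a u E.
    + eapply prv_eq_trans; [exact (prv_rec1_zero (Var 0) zero c E)|].
      exact (prv_impE H E).
    + exact (prv_rec1_succ (Var 0) zero c E).
Qed.

Lemma equiv_monus s t :
  equiv T (Eq s t) (And (Eq (monus s t) zero) (Eq (monus t s) zero)).
Proof.
  assert (Z : forall G v, prv T G (Eq (monus v v) zero)).
  { intros G v. eapply prv_eq_trans; [apply prv_eq_sym, prv_monus_succ_succ|].
    apply prv_lt_succ_diag. }
  intros G; split; intros H.
  - apply prv_andI; (eapply prv_eq_trans; [|apply (Z G t)]);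
      apply prv_eq_app2; auto using prv_eq_refl.
  - assert (L : forall v w, prv T G (Eq (monus v w) zero) ->
                       prv T G (Or (Lt w v) (Eq w v))).
    { intros v w K. apply prv_lt_succ_cases.
      eapply prv_eq_trans; [apply prv_monus_succ_succ|exact K]. }
    pose proof (L _ _ (prv_andE1 H)) as H1. pose proof (L _ _ (prv_andE2 H)) as H2.
    clear L. por H1 K1; [por H2 K2|apply prv_eq_sym, K1].
    + apply prv_lt_irrefl with s. exact (prv_lt_trans K2 K1).
    + exact K2.
Qed.

Fixpoint char (A : formula) : term :=
  match A with
  | Eq s t => app2 prim_and (monus s t) (monus t s)
  | And B C => app2 prim_and (char B) (char C)
  | Or B C => app2 prim_or (char B) (char C)
  | Imp B C => app2 prim_imp (char B) (char C)
  | _ => one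
  end.

Lemma equiv_char A : quantifier_free A -> equiv T (Eq (char A) zero) A.
Proof.
  induction A; cbn [char quantifier_free]; intros Q G; try contradiction.
  - split; [apply prv_succ_zero|apply prv_botE].
  - rewrite (equiv_prim_and _ _ G). symmetry. apply equiv_monus.
  - destruct Q as [Q1 Q2]. rewrite (equiv_prim_and _ _ G).
    split; intros H; apply prv_andI;
      (apply IHA1 || apply IHA2); auto; (apply (prv_andE1 H) || apply (prv_andE2 H)).
  - destruct Q as [Q1 Q2]. rewrite (equiv_prim_or _ _ G).
    split; intros H; por H K;
      (apply prv_orI1, IHA1; assumption) || (apply prv_orI2, IHA2; assumption).
  - destruct Q as [Q1 Q2]. rewrite (equiv_prim_imp _ _ G).
    split; intros H; pintro K; apply IHA2; auto; apply (prv_impE H), IHA1; auto.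
Qed.

Lemma equiv_subst A B (r : nat -> term) : equiv T A B -> equiv T (subst r A) (subst r B).
Proof.
  assert (M : forall A B, equiv T A B -> forall G,
    prv T G (subst r A) -> prv T G (subst r B)).
  { clear A B. intros A B H G. apply prv_impE.
    apply prv_weaken with (G := []); [|intros ? []]. apply prv_impI.
    apply (prv_subst (G := [A])). apply H, prv_head. }
  intros H G; split; apply M; [exact H|]. intros G'; symmetry; apply H.
Qed.

(** The function [P] with [P 0 us = 1] and
    [P (y + 1) us = prim_or (P y us) (char A)]. In the recursion step the
    variables are [y], the previous value, then [us], so those of [char A]
    other than [y] move up by one. *)
Definition bounded_search (n : nat) (A : formula) : prim (S n) :=
  prim_rec n one
    (app2 prim_or (Var 1)
      (subst_term (fun i => match i with 0 => Var 0 | S j => Var (S (S j)) end)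
         (char A))).

Lemma equiv_bounded_search n A (us : Vector.t term n) : quantifier_free A -> forall x,
  equiv T (Eq (App (bounded_search n A) (Vector.cons term x _ us)) zero)
          (Ex_lt x (subst (up (env us)) A)).
Proof.
  intros Q.
  pose (A' := subst (up (env us)) A). fold A'.
  pose (p := App (bounded_search n A)
    (Vector.cons term (Var 0) _ (Vector.map (subst_term shift) us))).
  assert (Hp : forall x,
    App (bounded_search n A) (Vector.cons term x _ us) = subst_term (x .: Var) p).
  { intros x. unfold p. cbn. do 2 f_equal. rewrite Vector.map_map. symmetry.
    etransitivity; [|apply Vector.map_id]. apply Vector.map_ext. intros t.
    rewrite subst_term_comp. apply subst_term_id. reflexivity. }
  assert (P0 : forall G, prv T G (Eq (subst_term (zero .: Var) p) one)).
  { intros G. rewrite <- Hp. apply prv_prim_rec_zero. }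
  assert (PS : forall G x, prv T G (Eq (subst_term (succ x .: Var) p)
     (app2 prim_or (subst_term (x .: Var) p) (subst_term (x .: env us) (char A))))).
  { intros G x. rewrite <- !Hp. eapply prv_eq_trans; [apply prv_prim_rec_succ|].
    match goal with |- prv _ _ (Eq ?a ?b) => replace a with b by sbterm end.
    apply prv_eq_refl. }
  assert (CA : forall x, equiv T (Eq (subst_term (x .: env us) (char A)) zero) (inst A' x)).
  { intros x. replace (inst A' x) with (subst (x .: env us) A) by (unfold A'; sb).
    exact (equiv_subst (x .: env us) (equiv_char _ Q)). }
  assert (M : forall x G, prv T G
    (And (Imp (Eq (subst_term (x .: Var) p) zero) (Ex_lt x A'))
         (Imp (Ex_lt x A') (Eq (subst_term (x .: Var) p) zero)))).
  { intros x G. revert x. clearbody p A'. apply prv_induction with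
      (F := fun x => And (Imp (Eq (subst_term (x .: Var) p) zero) (Ex_lt x A'))
         (Imp (Ex_lt x A') (Eq (subst_term (x .: Var) p) zero)))
      (A := And
         (Imp (Eq (subst_term (Var 0 .: shift) p) zero)
              (Ex_lt (Var 0) (subst (up shift) A')))
         (Imp (Ex_lt (Var 0) (subst (up shift) A'))
              (Eq (subst_term (Var 0 .: shift) p) zero))).
    - intros x. sb.
    - apply prv_andI.
      + pintro H. apply prv_succ_zero with zero.
        eapply prv_eq_trans; [apply prv_eq_sym, P0|exact H].
      + pintro H. pexlt H y H1 H2. apply prv_lt_zero with y, H1.
    - intros x. phead IH. apply prv_andI.
      + pintro H. assert (K := prv_eq_trans (prv_eq_sym (PS _ x)) H).
        apply equiv_prim_or in K. por K L.
        * assert (N := prv_impE (prv_andE1 IH) L). pexlt N y H1 H2.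
          apply prv_ex_ltI with y; auto using prv_lt_succ.
        * apply CA in L. apply prv_ex_ltI with x; auto using prv_lt_succ_diag.
      + pintro H. eapply prv_eq_trans; [apply PS|]. apply equiv_prim_or.
        pexlt H y H1 H2. apply prv_lt_succ_cases in H1. por H1 L.
        * apply prv_orI1, (prv_impE (prv_andE2 IH)).
          apply prv_ex_ltI with y; auto.
        * apply prv_orI2, CA. exact (prv_leibniz A' L H2). }
  intros x G. rewrite Hp. specialize (M x G).
  split; apply prv_impE; [apply (prv_andE1 M)|apply (prv_andE2 M)].
Qed.

Lemma qf_ex_lt t A : quantifier_free A ->
  exists C, quantifier_free C /\ equiv T (Ex_lt t A) C.
Proof.
  intros Q.
  exists (Eq (App (bounded_search (bound A) A)
                (Vector.cons term t _ (vars (bound A)))) zero).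
  split; [exact I|]. intros G. rewrite (equiv_bounded_search A (vars (bound A)) Q t G).
  replace (subst (up (env (vars (bound A)))) A) with A; [reflexivity|].
  rewrite <- (subst_id A Var) at 1 by reflexivity. apply subst_ext_bound.
  intros [|i] Hi; [reflexivity|]. cbn. rewrite env_vars by lia. reflexivity.
Qed.
End Recursion.

(** * The prenex classes up to provable equivalence *)

(** The polarity [true] stands for [Ex] and [Sigma], and [false] for [All] and
    [Pi], so that dual facts share one proof. *)
Definition quant (b : bool) : formula -> formula := if b then Ex else All.
Definition prenex_class (b : bool) (k : nat) : formula -> Prop :=
  if b then Sigma k else Pi k.

Lemma prenex_class_succ b k A :
  prenex_class b (S k) A <->
  exists n B, 1 <= n /\ prenex_class (negb b) k B /\ A = Nat.iter n (quant b) B.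
Proof. destruct b; reflexivity. Qed.

Lemma prenex_class_zero b A : prenex_class b 0 A <-> quantifier_free A.
Proof. destruct b; reflexivity. Qed.

Lemma subst_quant b s A : subst s (quant b A) = quant b (subst (up s) A).
Proof. destruct b; reflexivity. Qed.

Lemma subst_iter_quant b n : forall s A,
  subst s (Nat.iter n (quant b) A) = Nat.iter n (quant b) (subst (Nat.iter n up s) A).
Proof.
  induction n as [|n IH]; intros s A; [reflexivity|].
  rewrite (Nat.iter_succ_r n _ up), !Nat.iter_succ, subst_quant, IH. reflexivity.
Qed.

Lemma quantifier_free_subst A s : quantifier_free A -> quantifier_free (subst s A).
Proof. induction A; cbn; tauto. Qed.

Lemma prenex_class_subst k : forall b A s,
  prenex_class b k A -> prenex_class b k (subst s A).
Proof.
  induction k as [|k IH]; intros b A s.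
  - rewrite !prenex_class_zero. apply quantifier_free_subst.
  - rewrite !prenex_class_succ. intros (n & B & Hn & HB & ->).
    exists n, (subst (Nat.iter n up s) B). repeat split; auto using subst_iter_quant.
Qed.

Definition entails (T : formula -> Prop) (A B : formula) : Prop :=
  forall G, prv T G A -> prv T G B.

Definition cls (T : formula -> Prop) (b : bool) (k : nat) (A : formula) : Prop :=
  exists A', prenex_class b k A' /\ equiv T A A'.

(** For decidable [c], equivalent to the disjunction of [c /\ A] and
    [~ c /\ B]. Being a case distinction, it commutes with all quantifiers
    without any classical principle. *)
Definition cond (c A B : formula) : formula := And (Imp c A) (Imp (Neg c) B).

Section Classes.
Context {T : formula -> Prop} {HT : arith T}.
Implicit Types (G : list formula) (t : term) (s : nat -> term) (b : bool).

Lemma entails_intro A B : prv T [A] B -> entails T A B.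
Proof.
  intros H G. apply prv_impE. apply prv_weaken with (G := []); [|intros ? []].
  apply prv_impI, H.
Qed.

Lemma entails_subst A B s : entails T A B -> entails T (subst s A) (subst s B).
Proof.
  intros H. apply entails_intro. apply (prv_subst (G := [A])). apply H, prv_head.
Qed.

Lemma prv_subst_nil A : (forall G, prv T G A) -> forall G s, prv T G (subst s A).
Proof.
  intros H G s. apply prv_weaken with (G := []); [|intros ? []].
  exact (prv_subst (H []) s).
Qed.

Lemma equiv_entails A B : entails T A B -> entails T B A -> equiv T A B.
Proof. split; auto. Qed.

Lemma equiv_refl A : equiv T A A.
Proof. intros G; reflexivity. Qed.

Lemma equiv_sym A B : equiv T A B -> equiv T B A.
Proof. intros H G; symmetry; apply H. Qed.

Lemma equiv_trans A B C : equiv T A B -> equiv T B C -> equiv T A C.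
Proof. intros H K G; rewrite (H G); apply K. Qed.

Lemma entails_imp A A' B B' :
  entails T A' A -> entails T B B' -> entails T (Imp A B) (Imp A' B').
Proof. intros H K G L. pintro M. apply K, (prv_impE L), H, M. Qed.

Lemma entails_quant b A B : entails T A B -> entails T (quant b A) (quant b B).
Proof.
  intros H G. destruct b; cbn; intros K.
  - pex K t L. apply prv_exI with t. exact (@entails_subst A B _ H _ L).
  - pall t. apply (@entails_subst A B _ H). exact (prv_allE t K).
Qed.

Lemma equiv_quant b A B : equiv T A B -> equiv T (quant b A) (quant b B).
Proof. intros H. apply equiv_entails; apply entails_quant; intros G; apply H. Qed.

Lemma equiv_imp A A' B B' :
  equiv T A A' -> equiv T B B' -> equiv T (Imp A B) (Imp A' B').
Proof.
  intros H K. apply equiv_entails; apply entails_imp; intros G; apply H || apply K.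
Qed.

Lemma equiv_neg A B : equiv T A B -> equiv T (Neg A) (Neg B).
Proof. intros H. apply equiv_imp; [exact H|apply equiv_refl]. Qed.

Lemma equiv_and A A' B B' :
  equiv T A A' -> equiv T B B' -> equiv T (And A B) (And A' B').
Proof.
  intros H K G; split; intros L; apply prv_andI;
    (apply H, (prv_andE1 L)) || (apply K, (prv_andE2 L)).
Qed.

Lemma equiv_or A A' B B' :
  equiv T A A' -> equiv T B B' -> equiv T (Or A B) (Or A' B').
Proof.
  intros H K G; split; intros L; por L M;
    (apply prv_orI1, H, M) || (apply prv_orI2, K, M).
Qed.

Lemma equiv_cond c A A' B B' :
  equiv T A A' -> equiv T B B' -> equiv T (cond c A B) (cond c A' B').
Proof. intros; apply equiv_and; apply equiv_imp; auto using equiv_refl. Qed.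

Lemma equiv_ex_lt t A B : equiv T A B -> equiv T (Ex_lt t A) (Ex_lt t B).
Proof. intros H. apply (equiv_quant true), equiv_and; auto using equiv_refl. Qed.

Lemma equiv_all_lt t A B : equiv T A B -> equiv T (All_lt t A) (All_lt t B).
Proof. intros H. apply (equiv_quant false), equiv_imp; auto using equiv_refl. Qed.

Lemma equiv_vacuous b A : equiv T A (quant b (lift A)).
Proof.
  intros G; destruct b; cbn; split; intros H.
  - apply prv_exI with zero. rewrite inst_lift. exact H.
  - pex H t K. rewrite inst_lift in *. exact K.
  - pall t. rewrite inst_lift. exact H.
  - apply (prv_allE zero) in H. rewrite inst_lift in H. exact H.
Qed.

Lemma cls_equiv b k A B : equiv T A B -> cls T b k B -> cls T b k A.
Proof.
  intros H (C & HC & K). exists C. split; [exact HC|]. now apply equiv_trans with B.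
Qed.

Lemma cls_base b k A : prenex_class b k A -> cls T b k A.
Proof. intros H; exists A; split; [exact H|apply equiv_refl]. Qed.

Lemma cls_subst b k A s : cls T b k A -> cls T b k (subst s A).
Proof.
  intros (B & HB & H). exists (subst s B).
  split; [now apply prenex_class_subst|now apply equiv_subst].
Qed.

(** By a vacuous quantifier. *)
Lemma cls_switch b k A : cls T (negb b) k A -> cls T b (S k) A.
Proof.
  intros (B & HB & H). exists (quant b (lift B)). split.
  - apply prenex_class_succ. exists 1, (lift B).
    repeat split; [lia|now apply prenex_class_subst].
  - now apply equiv_trans with B; [|apply equiv_vacuous].
Qed.

Lemma cls_quant b k A : cls T b (S k) A -> cls T b (S k) (quant b A).
Proof.
  intros (B & HB & H). exists (quant b B). split; [|now apply equiv_quant].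
  apply prenex_class_succ in HB as (n & C & Hn & HC & ->).
  apply prenex_class_succ. exists (S n), C. repeat split; auto.
Qed.

(** Induction on the length of the leading quantifier block. *)
Lemma cls_ind b k (R : formula -> Prop) :
  (forall A B, equiv T A B -> R B -> R A) ->
  (forall A, cls T (negb b) k A -> R A) ->
  (forall A, cls T b (S k) A -> R A -> R (quant b A)) ->
  forall A, cls T b (S k) A -> R A.
Proof.
  intros HE H0 HS A (B & HB & H). apply HE with B; [exact H|]. clear A H.
  apply prenex_class_succ in HB as (n & C & _ & HC & ->).
  assert (K : cls T b (S k) (Nat.iter n (quant b) C) /\ R (Nat.iter n (quant b) C)).
  { induction n as [|n [IH1 IH2]]; cbn.
    - split; [apply cls_switch, cls_base, HC|apply H0, cls_base, HC].
    - split; [apply cls_quant, IH1|apply HS; assumption]. }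
  apply K.
Qed.

(** Vacuous quantifiers of the alternating kind are added at the matrix. *)
Lemma cls_succ k : forall b A, cls T b k A -> cls T b (S k) A.
Proof.
  induction k as [|k IH]; intros b A H.
  - apply cls_switch. destruct H as (B & HB & K). exists B. split; [|exact K].
    revert HB. rewrite !prenex_class_zero. trivial.
  - revert A H. apply cls_ind.
    + intros A B H; now apply cls_equiv.
    + intros A H. apply cls_switch, IH, H.
    + intros A _. apply cls_quant.
Qed.

Lemma cls_le b i k A : i <= k -> cls T b i A -> cls T b k A.
Proof. induction 1; auto using cls_succ. Qed.

Lemma cls_lt b b' i k A : i < k -> cls T b i A -> cls T b' k A.
Proof.
  intros Hk H. destruct k as [|k]; [lia|]. destruct (Bool.bool_dec b b') as [<-|N].
  - apply cls_le with i; [lia|exact H].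
  - apply cls_switch. replace (negb b') with b by (destruct b, b'; cbn; congruence).
    apply cls_le with i; [lia|exact H].
Qed.

Lemma cls_qf b k A : quantifier_free A -> cls T b k A.
Proof.
  intros Q. apply cls_le with 0; [lia|]. apply cls_base, prenex_class_zero, Q.
Qed.

Lemma prv_cond_true c A B G : prv T G c -> prv T G A -> prv T G (cond c A B).
Proof.
  intros H K. apply prv_andI; pintro L; [exact K|].
  apply prv_botE. exact (prv_impE L H).
Qed.

Lemma prv_cond_false c A B G : prv T G (Neg c) -> prv T G B -> prv T G (cond c A B).
Proof.
  intros H K. apply prv_andI; pintro L; [|exact K].
  apply prv_botE. exact (prv_impE H L).
Qed.

Lemma inst_cond c A B t : inst (cond c A B) t = cond (inst c t) (inst A t) (inst B t).
Proof. reflexivity. Qed.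

Lemma equiv_cond_quant_l b c A B : quantifier_free c ->
  equiv T (cond c (quant b A) B) (quant b (cond (lift c) A (lift B))).
Proof.
  intros Q G. pose proof (prv_qf_dec c Q G) as D. destruct b; cbn; split; intros H.
  - por D K.
    + assert (L := prv_impE (prv_andE1 H) K). pex L t M. apply prv_exI with t.
      rewrite inst_cond, !inst_lift. now apply prv_cond_true.
    + apply prv_exI with zero. rewrite inst_cond, !inst_lift.
      apply prv_cond_false; [exact K|]. exact (prv_impE (prv_andE2 H) K).
  - pex H t L. rewrite inst_cond, !inst_lift in *. por D K.
    + apply prv_cond_true; [exact K|]. apply prv_exI with t.
      exact (prv_impE (prv_andE1 L) K).
    + apply prv_cond_false; [exact K|]. exact (prv_impE (prv_andE2 L) K).
  - pall t. rewrite inst_cond, !inst_lift. por D K.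
    + apply prv_cond_true; [exact K|].
      exact (prv_allE t (prv_impE (prv_andE1 H) K)).
    + apply prv_cond_false; [exact K|]. exact (prv_impE (prv_andE2 H) K).
  - por D K.
    + apply prv_cond_true; [exact K|]. pall t. apply (prv_allE t) in H.
      rewrite inst_cond, !inst_lift in H. exact (prv_impE (prv_andE1 H) K).
    + apply prv_cond_false; [exact K|]. apply (prv_allE zero) in H.
      rewrite inst_cond, !inst_lift in H. exact (prv_impE (prv_andE2 H) K).
Qed.

Lemma equiv_cond_neg c A B : quantifier_free c ->
  equiv T (cond c A B) (cond (Neg c) B A).
Proof.
  intros Q G; pose proof (prv_qf_dec c Q G) as D; split; intros H; por D K.
  - apply prv_cond_false; [|exact (prv_impE (prv_andE1 H) K)].
    pintro L. exact (prv_impE L K).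
  - apply prv_cond_true; [exact K|exact (prv_impE (prv_andE2 H) K)].
  - apply prv_cond_true; [exact K|]. apply (prv_impE (prv_andE2 H)).
    pintro L. exact (prv_impE L K).
  - apply prv_cond_false; [exact K|exact (prv_impE (prv_andE1 H) K)].
Qed.

(** Pulls out the block of [A], then that of [B], and descends a level. *)
Lemma cls_cond k : forall b c A B, quantifier_free c ->
  cls T b k A -> cls T b k B -> cls T b k (cond c A B).
Proof.
  induction k as [|k IH]; intros b c A B Q HA HB.
  - destruct HA as (A' & QA & HA), HB as (B' & QB & HB).
    exists (cond c A' B'). split; [|now apply equiv_cond].
    rewrite prenex_class_zero in *. cbn; tauto.
  - revert A HA c B Q HB. apply (cls_ind (fun A => forall c B,
      quantifier_free c -> cls T b (S k) B -> cls T b (S k) (cond c A B))).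
    + intros A A' H K c B Q HB. eapply cls_equiv; [|exact (K c B Q HB)].
      apply equiv_cond; auto using equiv_refl.
    + intros A HA c B Q HB. revert B HB c A HA Q.
      apply (cls_ind (fun B => forall c A,
        cls T (negb b) k A -> quantifier_free c -> cls T b (S k) (cond c A B))).
      * intros B B' H K c A HA Q. eapply cls_equiv; [|exact (K c A HA Q)].
        apply equiv_cond; auto using equiv_refl.
      * intros B HB c A HA Q. apply cls_switch; auto.
      * intros B _ HB c A HA Q. eapply cls_equiv; [now apply equiv_cond_neg|].
        eapply cls_equiv; [apply equiv_cond_quant_l; cbn; tauto|].
        apply cls_quant. eapply cls_equiv; [apply equiv_sym, (equiv_cond_neg (lift c))|].
        -- now apply quantifier_free_subst.
        -- apply HB; [now apply cls_subst|now apply quantifier_free_subst].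
    + intros A _ HA c B Q HB.
      eapply cls_equiv; [now apply equiv_cond_quant_l|].
      apply cls_quant, HA; [now apply quantifier_free_subst|now apply cls_subst].
Qed.

(** A conjunction with [y < t] is a case distinction with [Bot] in the other
    case, so above level [0] the bounded quantifier joins the leading block. *)
Lemma cls_ex_lt_sigma k t A : cls T true k A -> cls T true k (Ex_lt t A).
Proof.
  intros H. destruct k as [|k].
  - destruct H as (B & QB & H). destruct (qf_ex_lt t _ QB) as (C & QC & K).
    exists C. split; [exact QC|]. eapply equiv_trans; [apply equiv_ex_lt, H|exact K].
  - apply (cls_quant (b := true)). eapply cls_equiv; [|apply cls_cond with
      (c := Lt (Var 0) (↑ t)) (B := Bot); [exact I|exact H|now apply cls_qf]].
    intros G; split; intros K.
    + apply prv_cond_true; [exact (prv_andE1 K)|exact (prv_andE2 K)].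
    + pose proof (prv_qf_dec (Lt (Var 0) (↑ t)) I G) as D. por D L.
      * apply prv_andI; [exact L|exact (prv_impE (prv_andE1 K) L)].
      * apply prv_botE, (prv_impE (prv_andE2 K) L).
Qed.
End Classes.

(** * Duals and excluded middle *)

Inductive prenex : formula -> Prop :=
| prenex_qf A : quantifier_free A -> prenex A
| prenex_quant b A : prenex A -> prenex (quant b A).

Lemma prenex_class_prenex k : forall b A, prenex_class b k A -> prenex A.
Proof.
  induction k as [|k IH]; intros b A.
  - rewrite prenex_class_zero. apply prenex_qf.
  - rewrite prenex_class_succ. intros (n & B & _ & HB & ->).
    apply IH in HB. induction n; [exact HB|]. now apply prenex_quant.
Qed.

Lemma dual_subst A : forall s, dual (subst s A) = subst s (dual A).
Proof. induction A; intros r; cbn; f_equal; auto. Qed.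

Lemma dual_lift A : dual (lift A) = lift (dual A).
Proof. apply dual_subst. Qed.

Lemma dual_inst A t : dual (inst A t) = inst (dual A) t.
Proof. apply dual_subst. Qed.

Lemma dual_qf A : quantifier_free A -> dual A = Neg A.
Proof. destruct A; cbn; tauto. Qed.

Lemma dual_quant b A : dual (quant b A) = quant (negb b) (dual A).
Proof. destruct b; reflexivity. Qed.

Lemma dual_class k : forall b A, prenex_class b k A -> prenex_class (negb b) k (dual A).
Proof.
  induction k as [|k IH]; intros b A.
  - rewrite !prenex_class_zero. intros Q. rewrite dual_qf by exact Q. cbn; tauto.
  - rewrite !prenex_class_succ. intros (n & B & Hn & HB & ->).
    exists n, (dual B). repeat split; [exact Hn|apply IH, HB|].
    clear. induction n as [|n IH]; [reflexivity|].
    rewrite !Nat.iter_succ, dual_quant, IH. reflexivity.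
Qed.

Definition stable (T : formula -> Prop) (A : formula) : Prop :=
  entails T (Neg (Neg A)) A.

Definition decidable (T : formula -> Prop) (A : formula) : Prop :=
  forall G, prv T G (Or A (Neg A)).

Section Duality.
Context {T : formula -> Prop} {HT : arith T}.
Implicit Types (G : list formula) (t : term) (s : nat -> term) (b : bool).

Lemma stable_equiv A B : equiv T A B -> stable T B -> stable T A.
Proof.
  intros H K G L. apply H, K. apply (equiv_neg (equiv_neg H)). exact L.
Qed.

Lemma stable_subst A s : stable T A -> stable T (subst s A).
Proof. apply (@entails_subst T HT (Neg (Neg A)) A s). Qed.

Lemma decidable_equiv A B : equiv T A B -> decidable T B -> decidable T A.
Proof.
  intros H K G. apply (equiv_or H (equiv_neg H)), K.
Qed.

Lemma decidable_subst A s : decidable T A -> decidable T (subst s A).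
Proof. intros H G. exact (prv_subst_nil H G s). Qed.

Lemma decidable_stable A : decidable T A -> stable T A.
Proof.
  intros H G K. specialize (H G). por H L; [exact L|].
  apply prv_botE. exact (prv_impE K L).
Qed.

Lemma dual_contra A : prenex A -> entails T A (Neg (dual A)).
Proof.
  induction 1 as [A Q|b A _ IH].
  - rewrite dual_qf by exact Q. intros G H. pintro K. exact (prv_impE K H).
  - rewrite dual_quant. intros G H. pintro K. destruct b; cbn in *.
    + pex H t L. apply (prv_allE t) in K. rewrite <- dual_inst in *.
      apply (entails_subst (t .: Var)) in IH.
      refine (prv_impE (IH _ L) _). rewrite <- dual_subst. exact K.
    + pex K t L. apply (prv_allE t) in H.
      apply (entails_subst (t .: Var)) in IH.
      exact (prv_impE (IH _ H) L).
Qed.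

Lemma dual_neg A : prenex A -> entails T (dual A) (Neg A).
Proof.
  intros P G H. pintro K. exact (prv_impE (dual_contra P K) H).
Qed.

Lemma dual_dual A : prenex A -> entails T (dual (dual A)) A.
Proof.
  induction 1 as [A Q|b A _ IH].
  - rewrite !dual_qf by (rewrite ?dual_qf; cbn; tauto).
    apply decidable_stable. intros G. now apply prv_qf_dec.
  - rewrite !dual_quant. rewrite Bool.negb_involutive. now apply entails_quant.
Qed.

Lemma neg_dual_ex A : entails T (Neg A) (dual A) ->
  entails T (Neg (Ex A)) (dual (Ex A)).
Proof.
  intros H G K. cbn. pall t. apply (entails_subst (t .: Var)) in H.
  apply H. cbn. pintro L. exact (prv_impE K (prv_exI _ _ L)).
Qed.

Lemma neg_dual_iter_ex n A : entails T (Neg A) (dual A) ->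
  entails T (Neg (Nat.iter n Ex A)) (dual (Nat.iter n Ex A)).
Proof. intros H; induction n; [exact H|now apply neg_dual_ex]. Qed.

(** The two polarities are interleaved: for [A] universal of level [i + 1],
    [dual A] is existential of that level, so double negation elimination
    applies to it, and [~ dual A] gives [dual (dual A)] one level below. *)
Lemma neg_dual j : (forall A, Sigma j A -> stable T A) ->
  forall i, i <= j ->
    (forall A, Pi i A -> entails T (Neg A) (dual A)) /\
    (forall A, Sigma (S i) A -> entails T (Neg A) (dual A)).
Proof.
  intros D.
  assert (D' : forall i A, i <= j -> Sigma i A -> stable T A).
  { intros i A Hi HA. destruct (@cls_le T HT true i j A Hi) as (B & HB & K).
    - apply cls_base, HA.
    - exact (stable_equiv K (D B HB)). }
  assert (E : forall i, (forall A, Pi i A -> entails T (Neg A) (dual A)) ->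
              forall A, Sigma (S i) A -> entails T (Neg A) (dual A)).
  { intros i H A (n & B & _ & HB & ->). apply neg_dual_iter_ex, H, HB. }
  induction i as [|i IH]; intros Hi.
  - assert (H0 : forall A, Pi 0 A -> entails T (Neg A) (dual A)).
    { intros A Q. rewrite dual_qf by exact Q. intros G H; exact H. }
    exact (conj H0 (E _ H0)).
  - destruct (IH ltac:(lia)) as [_ IH2].
    assert (H1 : forall A, Pi (S i) A -> entails T (Neg A) (dual A)).
    { intros A HA G H.
      pose proof (dual_class (S i) false A HA) as HD.
      apply (D' (S i) (dual A) Hi HD). pintro K.
      apply (prv_impE H). apply dual_dual.
      - exact (prenex_class_prenex (S i) false A HA).
      - exact (IH2 (dual A) HD _ K). }
    exact (conj H1 (E _ H1)).
Qed.

(** Up to level [j] every formula of a class behaves classically: it is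
    decidable and its negation is in the opposite class. *)
Definition classical_to (T : formula -> Prop) (j : nat) : Prop :=
  forall b i A, i <= j -> cls T b i A ->
    decidable T A /\ cls T (negb b) i (Neg A).

Lemma lem_classical j : (forall A, Sigma j A -> decidable T A) -> classical_to T j.
Proof.
  intros D b i A Hi HA.
  pose proof (@neg_dual j (fun A HA => decidable_stable (D A HA))) as N.
  assert (D' : forall A, Sigma i A -> decidable T A).
  { intros B HB. destruct (@cls_le T HT true i j B Hi) as (C & HC & K).
    - apply cls_base, HB.
    - exact (decidable_equiv K (D C HC)). }
  assert (N' : forall b A, prenex_class b i A -> equiv T (Neg A) (dual A)).
  { intros b' B HB. apply equiv_entails.
    - destruct b'; [|exact (proj1 (N i Hi) B HB)]. destruct i as [|i].
      + exact (proj1 (N 0 Hi) B HB).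
      + exact (proj2 (N i ltac:(lia)) B HB).
    - apply dual_neg. exact (prenex_class_prenex i b' B HB). }
  destruct HA as (B & HB & K). split.
  - apply (decidable_equiv K). destruct b; [exact (D' B HB)|].
    intros G. pose proof (D' (dual B) (dual_class i false B HB) G) as L.
    por L M.
    + apply prv_orI2. apply (N' false B HB), M.
    + apply prv_orI1. apply dual_dual; [exact (prenex_class_prenex i false B HB)|].
      apply (N' true (dual B)); [exact (dual_class i false B HB)|exact M].
  - exists (dual B). split; [now apply dual_class|].
    eapply equiv_trans; [apply equiv_neg, K|apply (N' b B HB)].
Qed.
End Duality.

(** * Closure under bounded quantifiers *)

Definition increasing (T : formula -> Prop) (A : formula) : Prop :=
  forall G s v w, prv T G (Lt v w) ->
    prv T G (subst (v .: s) A) -> prv T G (subst (w .: s) A).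

Definition decreasing (T : formula -> Prop) (A : formula) : Prop :=
  forall G s v w, prv T G (Lt v w) ->
    prv T G (subst (w .: s) A) -> prv T G (subst (v .: s) A).

Section Bounded.
Context {T : formula -> Prop} {HT : arith T}.
Implicit Types (G : list formula) (t : term) (s : nat -> term) (b : bool).

Lemma prv_ex_lt_dec A : decidable T A ->
  forall x G, prv T G (Or (Ex_lt x A) (All_lt x (Neg A))).
Proof.
  intros D x G; revert x. apply prv_induction with
    (F := fun x => Or (Ex_lt x A) (All_lt x (Neg A)))
    (A := Or (Ex_lt (Var 0) (subst (up shift) A))
             (All_lt (Var 0) (Neg (subst (up shift) A)))).
  - intros x. sb.
  - apply prv_orI2. palllt u H. apply prv_lt_zero with u, H.
  - intros x. phead IH. por IH H.
    + apply prv_orI1. pexlt H u K L.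
      apply prv_ex_ltI with u; auto using prv_lt_succ.
    + match goal with |- prv _ ?G _ =>
        pose proof (decidable_subst (x .: Var) D G) as C end.
      por C K.
      * apply prv_orI1. apply prv_ex_ltI with x; [apply prv_lt_succ_diag|exact K].
      * apply prv_orI2. palllt u L. apply prv_lt_succ_cases in L. por L M.
        -- exact (prv_all_ltE H M).
        -- exact (prv_leibniz (Neg A) (prv_eq_sym M) K).
Qed.

Lemma equiv_ex_lt_dual t A : decidable T A ->
  equiv T (Ex_lt t A) (Neg (All_lt t (Neg A))).
Proof.
  intros D G; split; intros H.
  - pintro K. pexlt H u L M. exact (prv_impE (prv_all_ltE K L) M).
  - pose proof (prv_ex_lt_dec D t G) as C. por C K; [exact K|].
    apply prv_botE. exact (prv_impE H K).
Qed.

Lemma equiv_all_lt_dual t A : stable T A ->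
  equiv T (All_lt t A) (Neg (Ex_lt t (Neg A))).
Proof.
  intros D G; split; intros H.
  - pintro K. pexlt K u L M. exact (prv_impE M (prv_all_ltE H L)).
  - palllt u L.
    apply (stable_subst (u .: Var) D).
    cbn. pintro M. apply (prv_impE H). apply prv_ex_ltI with u; assumption.
Qed.

Lemma equiv_all_dual A : stable T A -> equiv T (All A) (Neg (Ex (Neg A))).
Proof.
  intros D G; split; intros H.
  - pintro K. pex K u L. exact (prv_impE L (prv_allE u H)).
  - pall u. apply (stable_subst (u .: Var) D).
    cbn. pintro M. apply (prv_impE H). apply prv_exI with u. exact M.
Qed.

Lemma cls_all_lt_pi j i t A : classical_to T j -> i <= j ->
  cls T false i A -> cls T false i (All_lt t A).
Proof.
  intros C Hi HA. destruct (C _ _ _ Hi HA) as [D N].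
  eapply cls_equiv; [apply equiv_all_lt_dual, decidable_stable, D|].
  apply (C true i); [exact Hi|]. apply cls_ex_lt_sigma, N.
Qed.

(** Contracts the leading block to one quantifier. Inductively
    [Ex u, Ex v, B] becomes [Ex v, Ex u < v, B]: as [B] is increasing in [v],
    a witness [v] can be raised above [u]. *)
Lemma increasing_normal_form i :
  (forall t A, cls T false i A -> cls T false i (Ex_lt t A)) ->
  forall A, cls T true (S i) A ->
    exists B, cls T false i B /\ increasing T B /\ equiv T A (Ex B).
Proof.
  intros HE. apply (cls_ind (b := true)).
  - intros A A' H (B & HB & M & K). exists B.
    repeat split; auto; now apply equiv_trans with A'.
  - intros A HA. exists (lift A). split; [now apply cls_subst|]. split.
    + intros G s v w _ K. conv K.
    + exact (equiv_vacuous true A).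
  - intros A _ (B & HB & M & K). exists (Ex_lt (Var 0) (swap B)). split; [|split].
    + apply HE. now apply cls_subst.
    + intros G s v w Hvw H.
      phyp H (Ex_lt v (subst (↑ v .: Var 0 .: fun i => ↑ (s i)) B)).
      pgoal (Ex_lt w (subst (↑ w .: Var 0 .: fun i => ↑ (s i)) B)).
      pexlt H u L N. phyp N (subst (v .: u .: s) B).
      apply prv_ex_ltI with u; [exact (prv_lt_trans L Hvw)|].
      pgoal (subst (w .: u .: s) B). exact (M _ _ _ _ Hvw N).
    + eapply equiv_trans; [apply (equiv_quant true), K|]. intros G; split; intros H.
      * pex H u L. pex L v N. phyp N (subst (v .: u .: Var) B).
        match goal with |- prv _ ?G _ => apply (@prv_upper_bound _ _ G u v) end.
        intros w. phead Q0. apply prv_exI with w.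
        pgoal (Ex_lt w (subst (↑ w .: Var 0 .: shift) B)).
        apply prv_ex_ltI with u; [exact (prv_andE1 Q0)|].
        pgoal (subst (w .: u .: Var) B). exact (M _ _ _ _ (prv_andE2 Q0) N).
      * pex H v L. phyp L (Ex_lt v (subst (↑ v .: Var 0 .: shift) B)).
        pexlt L u N Q0. apply prv_exI with u.
        pgoal (Ex (subst (Var 0 .: ↑ u .: shift) B)). apply prv_exI with v.
        pgoal (subst (v .: u .: Var) B). conv Q0.
Qed.

(** The collection schema, provable intuitionistically by induction on [t];
    monotonicity allows a common witness for the old bound and the new value. *)
Lemma equiv_collection B t : increasing T B ->
  equiv T (All_lt t (Ex B)) (Ex (All_lt (↑ t) (swap B))).
Proof.
  intros M G; split; intros H.
  - revert H. apply prv_impE. revert t. apply prv_induction with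
      (F := fun t => Imp (All_lt t (Ex B)) (Ex (All_lt (↑ t) (swap B))))
      (A := Imp (All_lt (Var 0) (Ex (subst (up (up shift)) B)))
                (Ex (All_lt (Var 1)
                   (subst (Var 1 .: Var 0 .: fun i => Var (S (S (S i)))) B)))).
    + intros t. sb.
    + pintro H. apply prv_exI with zero.
      pgoal (All_lt zero (subst (↑ zero .: Var 0 .: shift) B)).
      palllt u K. apply prv_lt_zero with u, K.
    + intros t. phead IH. pintro H.
      assert (K : forall G, prv T G (All_lt (succ t) (Ex B)) -> prv T G (All_lt t (Ex B))).
      { intros G' K. palllt u L. exact (prv_all_ltE K (prv_lt_succ L)). }
      assert (L := prv_impE IH (K _ H)). clear K IH.
      assert (K := prv_all_ltE H (prv_lt_succ_diag _ t)).
      pex L v N. pex K u Q0.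
      phyp N (All_lt t (subst (↑ v .: Var 0 .: shift) B)).
      phyp Q0 (subst (u .: t .: Var) B).
      match goal with |- prv _ ?G _ => apply (@prv_upper_bound _ _ G u v) end.
      intros w. phead P. apply prv_exI with w.
      pgoal (All_lt (succ t) (subst (↑ w .: Var 0 .: shift) B)).
      palllt y Q. pgoal (subst (w .: y .: Var) B).
      apply prv_lt_succ_cases in Q. por Q R.
      * apply (M _ _ v _ (prv_andE2 P)).
        assert (X := prv_all_ltE N R). conv X.
      * apply (M _ _ u _ (prv_andE1 P)).
        assert (X := prv_leibniz_at (swap B) (u .: Var) (prv_eq_sym R)).
        pcut (subst (t .: u .: Var) (swap B)) Y. { conv Q0. }
        specialize (X Y). conv X.
  - pex H v K. phyp K (All_lt t (subst (↑ v .: Var 0 .: shift) B)).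
    palllt y L. apply prv_exI with v. assert (X := prv_all_ltE K L). conv X.
Qed.

(** The universal quantifier in front of [Sigma_i] passes an existential
    quantifier by collection and then meets [Pi_(i-1)], where it is dual to an
    existential one in front of [Sigma_(i-1)]. The other half is the dual. *)
Lemma cls_bounded j i : classical_to T j -> i <= j ->
  (forall t A, cls T true i A -> cls T true i (All_lt t A)) /\
  (forall t A, cls T false i A -> cls T false i (Ex_lt t A)).
Proof.
  intros C.
  assert (E : forall i, i <= j ->
              (forall t A, cls T true i A -> cls T true i (All_lt t A)) ->
              forall t A, cls T false i A -> cls T false i (Ex_lt t A)).
  { intros i' Hi H t A HA. destruct (C _ _ _ Hi HA) as [D N].
    eapply cls_equiv; [apply equiv_ex_lt_dual, D|].
    apply (C true i'); [exact Hi|]. apply H, N. }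
  intros Hi. enough (H : forall t A, cls T true i A -> cls T true i (All_lt t A)) by auto.
  induction i as [|i IH]; intros t A HA.
  - exact (cls_all_lt_pi t C Hi HA).
  - destruct (@increasing_normal_form i) with (A := A) as (B & HB & M & K);
      [apply E; [lia|apply IH; lia]|exact HA|].
    eapply cls_equiv; [apply equiv_all_lt, K|].
    eapply cls_equiv; [now apply equiv_collection|].
    apply (cls_quant (b := true)), cls_switch. apply cls_all_lt_pi with j; [exact C|lia|].
    now apply cls_subst.
Qed.
End Bounded.

(** * Theories given by schemes *)

Lemma bound_iter_all n A : bound (Nat.iter n All A) = bound A - n.
Proof.
  induction n as [|n IH]; [cbn; lia|]. rewrite Nat.iter_succ. cbn [bound].
  rewrite IH. lia.
Qed.

Lemma closure_subst A s : subst s (closure A) = closure A.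
Proof.
  rewrite <- (subst_id (closure A) Var) at 2 by reflexivity. apply subst_ext_bound.
  unfold closure. rewrite bound_iter_all. lia.
Qed.

Instance sentences_HA_plus P : sentences (HA_plus P).
Proof. intros A s (B & _ & ->). apply closure_subst. Qed.

Lemma prv_all_nil T `{sentences T} A : prv T [] (All A) <-> prv T [] A.
Proof.
  split; intros K; [|now apply prv_allI].
  apply prv_subst with (s := shift) in K.
  apply (prv_allE (Var 0)) in K. conv K.
Qed.

Lemma prv_closure T `{sentences T} A : prv T [] (closure A) <-> prv T [] A.
Proof.
  unfold closure. induction (bound A) as [|n IH]; [reflexivity|].
  rewrite Nat.iter_succ. etransitivity; [now apply prv_all_nil|exact IH].
Qed.

Lemma HA_plus_instance P B G : HA_axiom B \/ P B -> prv (HA_plus P) G B.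
Proof.
  intros H. apply prv_weaken with (G := []); [|intros ? []].
  apply prv_closure; [apply sentences_HA_plus|]. apply prv_ax. exists B. auto.
Qed.

Instance arith_HA_plus P : arith (HA_plus P).
Proof.
  constructor; [apply sentences_HA_plus|]. intros G A H. apply HA_plus_instance. auto.
Qed.

Lemma HA_plus_entails (P : scheme) X Y : P (Imp X Y) -> entails (HA_plus P) X Y.
Proof. intros H G. apply prv_impE, HA_plus_instance. auto. Qed.

Lemma prv_theory_change T T' G A :
  (forall A, T' A -> prv T [] A) -> prv T' G A -> prv T G A.
Proof.
  intros HT. induction 1.
  - apply prv_weaken with (G := []); [now apply HT|intros ? []].
  - now apply prv_hyp.
  - now apply prv_botE.
  - now apply prv_andI.
  - eapply prv_andE1; eassumption.
  - eapply prv_andE2; eassumption.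
  - now apply prv_orI1.
  - now apply prv_orI2.
  - eapply prv_orE; eassumption.
  - now apply prv_impI.
  - eapply prv_impE; eassumption.
  - now apply prv_allI.
  - now apply prv_allE.
  - eapply prv_exI; eassumption.
  - eapply prv_exE; eassumption.
Qed.

Lemma HA_proves_from_trans P Q R :
  HA_proves_from P Q -> HA_proves_from Q R -> HA_proves_from P R.
Proof.
  intros HPQ HQR A HA. apply prv_theory_change with (T' := HA_plus Q); [|now apply HQR].
  intros B (C & [HC|HC] & ->); apply prv_closure; try apply sentences_HA_plus.
  - apply HA_plus_instance. auto.
  - now apply HPQ.
Qed.

(** * The disjunctive principles *)

Section Principles.
Context {T : formula -> Prop} {HT : arith T}.
Variable j : nat.
Implicit Types (G : list formula) (t : term) (s : nat -> term) (b : bool).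

Lemma dml_dual_of_dml :
  (forall A B, Sigma (S j) A -> Sigma (S j) B ->
     entails T (Neg (And A B)) (Or (Neg A) (Neg B))) ->
  (forall A, Sigma j A -> stable T A) ->
  forall A B, Sigma (S j) A -> Sigma (S j) B ->
    entails T (Neg (And A B)) (Or (dual A) (dual B)).
Proof.
  intros H D A B HA HB G K. pose proof (H A B HA HB G K) as L.
  destruct (@neg_dual T HT j D j (le_n j)) as [_ N]. por L M.
  - apply prv_orI1, N; assumption.
  - apply prv_orI2, N; assumption.
Qed.

Section FromDMLDual.
Hypothesis dml_dual : forall A B, Sigma (S j) A -> Sigma (S j) B ->
  entails T (Neg (And A B)) (Or (dual A) (dual B)).

Lemma dml_of_dml_dual A B : Sigma (S j) A -> Sigma (S j) B ->
  entails T (Neg (And A B)) (Or (Neg A) (Neg B)).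
Proof.
  intros HA HB G K. pose proof (dml_dual HA HB K) as L. por L M.
  - apply prv_orI1, dual_neg; [|exact M]. exact (prenex_class_prenex (S j) true A HA).
  - apply prv_orI2, dual_neg; [|exact M]. exact (prenex_class_prenex (S j) true B HB).
Qed.

(** Apply the principle to twice the formula [dual A], made existential by a
    vacuous quantifier: both disjuncts of the conclusion give [dual (dual A)]. *)
Lemma dne_of_dml_dual A : Sigma j A -> stable T A.
Proof.
  intros HA G H.
  assert (P : prenex A) by exact (prenex_class_prenex j true A HA).
  assert (HD : Sigma (S j) (Ex (lift (dual A)))).
  { exists 1, (lift (dual A)). repeat split; [lia|].
    apply (prenex_class_subst j false), (dual_class j true A HA). }
  pcut (Neg (And (Ex (lift (dual A))) (Ex (lift (dual A))))) K.
  { pintro K. apply (prv_impE H). apply dual_neg; [exact P|].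
    apply (equiv_vacuous true). exact (prv_andE1 K). }
  apply (dml_dual HD HD) in K.
  assert (L : prv T G (All (dual (lift (dual A))))) by (por K L; exact L).
  rewrite dual_lift in L. apply (equiv_vacuous false) in L.
  exact (dual_dual P L).
Qed.

Lemma or_dne_of_dml_dual A B : Pi (S j) A -> Pi (S j) B -> stable T (Or A B).
Proof.
  intros HA HB G H.
  assert (PA := prenex_class_prenex (S j) false A HA).
  assert (PB := prenex_class_prenex (S j) false B HB).
  pcut (Neg (And (dual A) (dual B))) K.
  { pintro K. apply (prv_impE H). pintro L. por L M.
    - exact (prv_impE (dual_contra PA M) (prv_andE1 K)).
    - exact (prv_impE (dual_contra PB M) (prv_andE2 K)). }
  apply (dml_dual (dual_class (S j) false A HA) (dual_class (S j) false B HB)) in K.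
  por K L; [apply prv_orI1|apply prv_orI2]; now apply dual_dual.
Qed.
End FromDMLDual.

Section FromCD.
Hypothesis cd : forall A B, cls T false (S j) A -> cls T false (S j) B ->
  entails T (All (Or (lift A) B)) (Or A (All B)).

(** Excluded middle level by level. To decide [Ex x C] for decidable [C], note
    that [Ex x C \/ dual C] holds for every [x]; [Ex x C] is in [Pi_k] up to
    equivalence because its level is below [k]. *)
Lemma or_dual_of_cd i A : i <= j -> Sigma i A -> forall G, prv T G (Or A (dual A)).
Proof.
  revert A; induction i as [|i IH]; intros A Hi HA.
  - rewrite dual_qf by exact HA. intros G. now apply prv_qf_dec.
  - destruct HA as (n & B & _ & HB & ->).
    assert (K : cls T true (S i) (Nat.iter n Ex B) /\
      cls T false (S i) (dual (Nat.iter n Ex B)) /\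
      forall G, prv T G (Or (Nat.iter n Ex B) (dual (Nat.iter n Ex B)))).
    { assert (HD := dual_class i false B HB).
      induction n as [|n (IH1 & IH2 & IH3)].
      - cbn. split; [|split].
        + apply cls_switch, cls_base, HB.
        + apply cls_switch, cls_base, HD.
        + intros G. pose proof (IH (dual B) ltac:(lia) HD G) as L. por L M.
          * apply prv_orI2, M.
          * apply prv_orI1, dual_dual; [|exact M].
            exact (prenex_class_prenex i false B HB).
      - rewrite Nat.iter_succ. set (C := Nat.iter n Ex B) in *.
        split; [now apply (cls_quant (b := true))|].
        split; [now apply (cls_quant (b := false))|].
        intros G. apply cd.
        + apply cls_lt with true (S i); [lia|]. now apply (cls_quant (b := true)).
        + apply cls_le with (S i); [lia|exact IH2].
        + pall t. pose proof (prv_subst_nil IH3 G (t .: Var)) as L.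
          pgoal (Or (Ex C) (inst (dual C) t)). cbn in L. por L M.
          * apply prv_orI1, prv_exI with t, M.
          * apply prv_orI2, M. }
    apply K.
Qed.

Lemma neg_dual_of_lem : (forall A, Sigma j A -> decidable T A) ->
  forall A, Sigma (S j) A -> entails T (Neg A) (dual A).
Proof.
  intros D. refine (proj2 (@neg_dual T HT j (fun A HA => _) j (le_n j))).
  apply decidable_stable, D, HA.
Qed.

Lemma decidable_of_cd A : Sigma j A -> decidable T A.
Proof.
  intros HA G. pose proof (or_dual_of_cd A (le_n j) HA G) as L. por L M.
  - apply prv_orI1, M.
  - apply prv_orI2, dual_neg; [exact (prenex_class_prenex j true A HA)|exact M].
Qed.

(** Induction on the leading block of [B]: its variables are moved out one at a
    time by [cd], until a decidable formula is left. *)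
Lemma dml_dual_of_cd A B : Sigma (S j) A -> Sigma (S j) B ->
  entails T (Neg (And A B)) (Or (dual A) (dual B)).
Proof.
  intros HA (n & C & _ & HC & ->).
  assert (N := neg_dual_of_lem decidable_of_cd).
  assert (HD := dual_class j false C HC).
  enough (K : cls T false (S j) (dual (Nat.iter n Ex C)) /\
    forall A, Sigma (S j) A ->
      entails T (Neg (And A (Nat.iter n Ex C))) (Or (dual A) (dual (Nat.iter n Ex C))))
    by (apply K; exact HA).
  clear A HA. induction n as [|n [IH1 IH2]].
  - cbn. split; [apply cls_switch, cls_base, HD|]. intros A HA G H.
    pose proof (or_dual_of_cd (dual C) (le_n j) HD G) as L. por L M.
    + apply prv_orI2, M.
    + apply prv_orI1, (N A HA). pintro K. apply (prv_impE H), prv_andI; [exact K|].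
      apply dual_dual; [exact (prenex_class_prenex j false C HC)|exact M].
  - rewrite Nat.iter_succ. set (B := Nat.iter n Ex C) in *.
    split; [now apply (cls_quant (b := false))|]. intros A HA G H.
    apply cd; [apply cls_base; exact (dual_class (S j) true A HA)|exact IH1|].
    rewrite <- dual_lift. apply prv_allI_terms. intros t.
    assert (HL : Sigma (S j) (lift A)) by exact (prenex_class_subst (S j) true A shift HA).
    pose proof (entails_subst (t .: Var)
      (IH2 (lift A) HL)) as K.
    apply K. pgoal (Neg (And A (inst B t))). pintro L. apply (prv_impE H).
    apply prv_andI; [exact (prv_andE1 L)|]. apply prv_exI with t, (prv_andE2 L).
Qed.
End FromCD.
End Principles.

(** * The collection principle *)

Section Collection.
Context {T : formula -> Prop} {HT : arith T}.
Implicit Types (G : list formula) (t : term) (s : nat -> term) (b : bool).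

Lemma entails_neg_neg A B : entails T A B -> entails T (Neg (Neg A)) (Neg (Neg B)).
Proof.
  intros H. apply entails_imp; [apply entails_imp; [exact H|]|]; intros G K; exact K.
Qed.

(** Index [0] of [A] is [v] and index [1] is [y]. By induction on [x]: to refute
    the negation of the conclusion for [x + 1], one may assume a [z] at which
    [A] fails for [y = x], since [A] is stable. For bounds [v > z] the witness
    [y <= x] then differs from [x], so the premise holds for [x]. *)
Lemma not_not_collection A x : stable T A -> decreasing T A ->
  entails T (All (Ex_lt (↑ x) (swap A))) (Neg (Neg (Ex_lt x (All A)))).
Proof.
  intros St M G. apply prv_impE. revert x. apply prv_induction with
    (F := fun x => Imp (All (Ex_lt (↑ x) (swap A))) (Neg (Neg (Ex_lt x (All A)))))
    (A := Imp (All (Ex_lt (Var 1)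
                (subst (Var 1 .: Var 0 .: fun i => Var (S (S (S i)))) A)))
              (Neg (Neg (Ex_lt (Var 0) (All (subst (up (up shift)) A)))))).
  - intros x. sb.
  - pintro H. pintro K. apply (prv_allE zero) in H.
    phyp H (Ex_lt zero (subst (↑ zero .: Var 0 .: shift) A)).
    pexlt H y L N. apply prv_lt_zero with y, L.
  - intros x. phead IH. pintro H. pintro K.
    assert (Sx : stable T (subst (Var 0 .: ↑ x .: shift) A)) by (apply stable_subst, St).
    pcut (Neg (All (subst (Var 0 .: ↑ x .: shift) A))) N.
    { pintro N. apply (prv_impE K). apply prv_ex_ltI with x; [apply prv_lt_succ_diag|].
      conv N. }
    apply (prv_impE N). apply (equiv_all_dual Sx). clear N.
    pintro N. pex N z P. phyp P (Neg (subst (z .: x .: Var) A)).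
    refine (prv_impE (prv_impE IH _) _).
    + pall w. pgoal (Ex_lt x (subst (↑ w .: Var 0 .: shift) A)).
      match goal with |- prv _ ?G _ => apply (@prv_upper_bound _ _ G z w) end.
      intros u. phead Q. apply (prv_allE u) in H.
      phyp H (Ex_lt (succ x) (subst (↑ u .: Var 0 .: shift) A)).
      pexlt H y L R. phyp R (subst (u .: y .: Var) A).
      apply prv_lt_succ_cases in L. por L X.
      * apply prv_ex_ltI with y; [exact X|]. pgoal (subst (w .: y .: Var) A).
        exact (M _ _ _ _ (prv_andE2 Q) R).
      * apply prv_botE, (prv_impE P). apply (M _ _ _ _ (prv_andE1 Q)).
        pose proof (prv_leibniz_at (swap A) (u .: Var) X) as Y.
        pcut (subst (y .: u .: Var) (swap A)) Z. { conv R. }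
        specialize (Y Z). conv Y.
    + pintro Q. apply (prv_impE K). pexlt Q y L R.
      apply prv_ex_ltI with y; [exact (prv_lt_succ L)|exact R].
Qed.

Section FromOrDNE.
Variable j : nat.
Hypothesis or_dne : forall A B, cls T false (S j) A -> cls T false (S j) B ->
  stable T (Or A B).

Lemma stable_of_or_dne A : cls T false (S j) A -> stable T A.
Proof.
  intros HA. apply stable_equiv with (Or A A); [|now apply or_dne].
  intros G; split; intros H; [now apply prv_orI1|]. por H K; exact K.
Qed.

Lemma neg_dual_of_or_dne A : Sigma (S j) A -> entails T (Neg A) (dual A).
Proof.
  refine (proj2 (@neg_dual T HT j (fun A HA => _) j (le_n j)) A).
  apply stable_of_or_dne, cls_lt with true j; [lia|]. now apply (@cls_base T true).
Qed.

(** [A \/ dual A] is itself a disjunction of formulas of [Pi_k] up to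
    equivalence, and its double negation holds because [~ A] gives [dual A]. *)
Lemma classical_of_or_dne : classical_to T j.
Proof.
  apply lem_classical. intros A HA G.
  assert (P := prenex_class_prenex j true A HA).
  assert (CA : cls T true j A) by now apply (@cls_base T true).
  assert (CD : cls T false j (dual A)).
  { apply cls_base. exact (dual_class j true A HA). }
  pcut (Or A (dual A)) K.
  { apply or_dne;
      [apply cls_lt with true j; [lia|exact CA]|apply cls_le with j; [lia|exact CD]|].
    pintro H.
    apply (prv_impE H), prv_orI2.
    pose proof (@neg_dual T HT j) as N.
    assert (D : forall A, Sigma j A -> stable T A).
    { intros C HC. apply stable_of_or_dne, cls_lt with true j; [lia|].
      now apply (@cls_base T true). }
    assert (NA : entails T (Neg A) (dual A)).
    { destruct j as [|i].
      - exact (proj1 (N D 0 (le_n 0)) A HA).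
      - exact (proj2 (N D i (Nat.le_succ_diag_r i)) A HA). }
    apply NA. pintro L. apply (prv_impE H), prv_orI1, L. }
  por K L; [apply prv_orI1, L|apply prv_orI2, dual_neg; assumption].
Qed.

(** The negation of the increasing normal form of the dual. *)
Lemma decreasing_normal_form A : cls T false (S j) A ->
  exists B, cls T true j B /\ decreasing T B /\ equiv T A (All B).
Proof.
  intros (A' & HA & E).
  assert (C := classical_of_or_dne).
  assert (HD := dual_class (S j) false A' HA).
  assert (P := prenex_class_prenex (S j) false A' HA).
  destruct (@increasing_normal_form T HT j) with (A := dual A') as (B & HB & M & K).
  - apply cls_bounded with j; [exact C|lia].
  - apply cls_base, HD.
  - exists (Neg B). split; [|split].
    + apply (C false j B (le_n j) HB).
    + intros G s v w H L. cbn in *. pintro N. exact (prv_impE L (M _ _ _ _ H N)).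
    + apply equiv_trans with (Neg (dual A')).
      { apply (equiv_trans E). apply equiv_entails; [apply (dual_contra P)|].
        intros G L. apply (dual_dual P). now apply neg_dual_of_or_dne. }
      apply equiv_trans with (Neg (Ex B)); [now apply equiv_neg|].
      intros G; split; intros L.
      * pall v. cbn. pintro N. exact (prv_impE L (prv_exI _ _ N)).
      * pintro N. pex N v Q. apply (prv_allE v) in L. exact (prv_impE L Q).
Qed.

(** Induction on [x]. With [D] equivalent to [All v, B], the formula
    [All v, Ex y < x, B] follows from [Ex y < x, D] and implies its double
    negation, and it is in [Pi_k] up to equivalence. So [or_dne] decides between
    it and the instance of [D] at [x]; in the first case the double negation
    feeds the induction hypothesis. *)
Lemma stable_ex_lt D x : cls T false (S j) D -> stable T (Ex_lt x D).
Proof.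
  intros HD. destruct (decreasing_normal_form HD) as (B & HB & M & E).
  destruct (classical_of_or_dne (le_n j) HB) as [DB _].
  assert (CE : forall x, cls T false (S j) (All (Ex_lt (↑ x) (swap B)))).
  { intros t. apply (cls_quant (b := false)), cls_switch. cbn.
    apply cls_ex_lt_sigma. now apply cls_subst. }
  intros G. apply prv_impE. revert x. apply prv_induction with
    (F := fun x => Imp (Neg (Neg (Ex_lt x D))) (Ex_lt x D))
    (A := Imp (Neg (Neg (Ex_lt (Var 0) (subst (up shift) D))))
              (Ex_lt (Var 0) (subst (up shift) D))).
  - intros x. sb.
  - pintro H. apply prv_botE, (prv_impE H). pintro K. pexlt K y L N.
    apply prv_lt_zero with y, L.
  - intros x. phead IH. pintro H.
    pcut (Or (All (Ex_lt (↑ x) (swap B))) (inst D x)) K.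
    { apply or_dne; [apply CE|now apply cls_subst|].
      pintro K. apply (prv_impE H). pintro L. pexlt L y N P.
      apply (prv_impE K). apply prv_lt_succ_cases in N. por N Q.
      - apply prv_orI1. pall v. pgoal (Ex_lt x (subst (↑ v .: Var 0 .: shift) B)).
        apply prv_ex_ltI with y; [exact Q|].
        apply (equiv_subst (y .: Var) E) in P.
        apply (prv_allE v) in P. conv P.
      - apply prv_orI2. exact (prv_leibniz D Q P). }
    por K L.
    + apply (not_not_collection x (decidable_stable DB) M) in L.
      assert (N : prv T (All (Ex_lt (↑ x) (swap B)) :: Neg (Neg (Ex_lt (succ x) D))
        :: Imp (Neg (Neg (Ex_lt x D))) (Ex_lt x D) :: G) (Ex_lt x D)).
      { apply (prv_impE IH). revert L. apply entails_neg_neg. intros G' L.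
        apply (equiv_ex_lt x E), L. }
      pexlt N y P Q. apply prv_ex_ltI with y; [exact (prv_lt_succ P)|exact Q].
    + apply prv_ex_ltI with x; [apply prv_lt_succ_diag|exact L].
Qed.

(** The premise says that [B], which is [A] for all [z] below [v], satisfies
    the premise of [not_not_collection]. *)
Lemma collcp_of_or_dne x A : Pi (S j) A ->
  entails T (All (Ex_lt (↑ x) (All_lt (Var 1) (subst (up (up shift)) A))))
            (Ex_lt x (All A)).
Proof.
  intros HA G H.
  assert (CA : cls T false (S j) A) by now apply (@cls_base T false).
  assert (SA := stable_of_or_dne CA).
  pose (B := All_lt (Var 0) (subst (Var 0 .: Var 2 .: fun i => Var (S (S (S i)))) A)).
  assert (SB : stable T B).
  { intros G' K. palllt u L.
    apply (stable_subst _ (stable_subst _ SA)). cbn. pintro N.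
    apply (prv_impE K). pintro P. apply (prv_impE N). exact (prv_all_ltE P L). }
  assert (MB : decreasing T B).
  { intros G' s v w L K.
    phyp K (All_lt w (subst (Var 0 .: ↑ (s 0) .: fun i => ↑ (s (S i))) A)).
    { unfold B; sb. }
    pgoal (All_lt v (subst (Var 0 .: ↑ (s 0) .: fun i => ↑ (s (S i))) A)).
    2:{ unfold B; sb. }
    palllt u N. exact (prv_all_ltE K (prv_lt_trans N L)). }
  apply (@stable_ex_lt (All A) x); [now apply (cls_quant (b := false))|].
  apply entails_neg_neg with (A := Ex_lt x (All B)).
  - intros G' K. pexlt K y L N. apply prv_ex_ltI with y; [exact L|].
    pall z. apply (prv_allE (succ z)) in N.
    phyp N (All_lt (succ z) (subst (Var 0 .: ↑ y .: shift) A)). { unfold B; sb. }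
    assert (P := prv_all_ltE N (prv_lt_succ_diag _ z)). conv P.
  - apply not_not_collection; [exact SB|exact MB|]. conv H. unfold B. sb.
Qed.
End FromOrDNE.

Definition two : term := succ (succ zero).

(** The number [y < 2] says which of [A] and [B] is chosen, in the formula [C];
    in the hypothesis [coll] the bound is the parameter of index [0], to be
    replaced by [two]. *)
Lemma cd_of_collcp j :
  (forall A G, Pi (S j) A -> prv T G (Imp
     (All (Ex_lt (Var 1) (All_lt (Var 1) (subst (up (up shift)) A))))
     (Ex_lt (Var 0) (All A)))) ->
  forall A B, cls T false (S j) A -> cls T false (S j) B ->
    entails T (All (Or (lift A) B)) (Or A (All B)).
Proof.
  intros coll A B HA HB.
  pose (C := cond (Eq (Var 1) zero) (lift (lift A)) (subst (up shift) B)).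
  assert (HC : cls T false (S j) C).
  { apply cls_cond; [exact I|now do 2 apply cls_subst|now apply cls_subst]. }
  (* The parameters of the prenex form of [C] are shifted to make room for the
     variable that bounds [y], which is then instantiated. *)
  assert (K : forall G, prv T G
    (Imp (All (Ex_lt two (All_lt (Var 1) (subst (up (up shift)) C))))
         (Ex_lt two (All C)))).
  { destruct HC as (C' & HC' & E).
    assert (K : forall G, prv T G (Imp (All (Ex_lt two (All_lt (Var 1)
       (subst (up (up shift)) C')))) (Ex_lt two (All C')))).
    { intros G.
      assert (HC2 : Pi (S j) (subst (up (up shift)) C'))
        by exact (prenex_class_subst (S j) false C' (up (up shift)) HC').
      pose proof (prv_subst_nil (fun G => coll _ G HC2) G (two .: Var)) as K.
      conv K. }
    clearbody C. intros G. eapply prv_impE; [|apply K]. apply prv_impI.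
    match goal with |- prv _ (?X :: ?G') _ => pose proof (prv_head T G' X) as L end.
    pintro H. apply (equiv_ex_lt two (equiv_quant false E)). apply (prv_impE L).
    revert H. apply (entails_quant false). intros G'.
    apply (equiv_ex_lt two). apply equiv_all_lt. now apply equiv_subst. }
  intros G H. specialize (K G).
  (* On initial segments the distribution over the disjunction is provable. *)
  assert (W : forall w, prv T G (Or A (All_lt w B))).
  { apply prv_induction with (F := fun w => Or A (All_lt w B))
      (A := Or (lift A) (All_lt (Var 0) (subst (up shift) B))).
    - intros w. sb.
    - apply prv_orI2. palllt u L. apply prv_lt_zero with u, L.
    - intros w. phead IH. apply (prv_allE w) in H.
      phyp H (Or A (inst B w)). por IH L; [apply prv_orI1, L|].
      por H N; [apply prv_orI1, N|]. apply prv_orI2. palllt u P.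
      apply prv_lt_succ_cases in P. por P Q.
      + exact (prv_all_ltE L Q).
      + exact (prv_leibniz B (prv_eq_sym Q) N). }
  pcut (Ex_lt two (All C)) L.
  { apply (prv_impE K). pall w.
    pgoal (Ex_lt two (All_lt (↑ w) C)).
    specialize (W w). clear K. por W N.
    - apply prv_ex_ltI with zero; [apply prv_zero_lt_succ|].
      pgoal (All_lt w (cond (Eq zero zero) (lift A) B)). 2:{ unfold C, cond. sb. }
      palllt u P. rewrite inst_cond, inst_lift.
      apply prv_cond_true; [apply prv_eq_refl|exact N].
    - apply prv_ex_ltI with one; [apply prv_lt_succ_succ, prv_zero_lt_succ|].
      pgoal (All_lt w (cond (Eq one zero) (lift A) B)). 2:{ unfold C, cond, one. sb. }
      palllt u P. rewrite inst_cond, inst_lift.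
      apply prv_cond_false; [pintro Q; exact (prv_succ_zero _ Q)|].
      exact (prv_all_ltE N P). }
  clear K W H. pexlt L y N P.
  phyp P (All (cond (Eq (↑ y) zero) (lift A) B)). { unfold C, cond. sb. }
  match goal with |- prv _ ?G _ => assert (D := prv_eq_dec G y zero) end.
  por D Q.
  - apply prv_orI1. apply (prv_allE zero) in P.
    rewrite inst_cond, inst_lift in P. apply (prv_impE (prv_andE1 P)). conv Q.
  - apply prv_orI2. pall z. apply (prv_allE z) in P.
    rewrite inst_cond, inst_lift in P. apply (prv_impE (prv_andE2 P)). conv Q.
Qed.
End Collection.

(** * The equivalences *)

Lemma entails_imp_nil T A B : entails T A B -> prv T [] (Imp A B).
Proof. intros H. apply prv_impI, H, prv_head. Qed.

Section Equivalences.
Variable j : nat.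

Lemma dml_dual_from_dml :
  HA_proves_from (plus (DML (Sigma (S j))) (DNE (Sigma j))) (DML_dual (Sigma (S j))).
Proof.
  intros X (A & B & HA & HB & ->). apply entails_imp_nil.
  apply dml_dual_of_dml with (j := j); [| |exact HA|exact HB].
  - intros A' B' HA' HB'. apply HA_plus_entails. left. exists A', B'. auto.
  - intros A' HA'. apply HA_plus_entails. right. exists A'. auto.
Qed.

Lemma dml_dual_instance A B : Sigma (S j) A -> Sigma (S j) B ->
  entails (HA_plus (DML_dual (Sigma (S j)))) (Neg (And A B)) (Or (dual A) (dual B)).
Proof. intros HA HB. apply HA_plus_entails. exists A, B. auto. Qed.

Lemma dml_from_dml_dual :
  HA_proves_from (DML_dual (Sigma (S j))) (plus (DML (Sigma (S j))) (DNE (Sigma j))).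
Proof.
  intros X [(A & B & HA & HB & ->)|(A & HA & ->)]; apply entails_imp_nil.
  - apply (@dml_of_dml_dual _ _ j dml_dual_instance); assumption.
  - apply (@dne_of_dml_dual _ _ j dml_dual_instance); assumption.
Qed.

Lemma or_dne_from_dml_dual :
  HA_proves_from (DML_dual (Sigma (S j))) (DNE (or_class (Pi (S j)) (Pi (S j)))).
Proof.
  intros X (A & (B & C & HB & HC & ->) & ->). apply entails_imp_nil.
  apply (@or_dne_of_dml_dual _ _ j dml_dual_instance); assumption.
Qed.

Lemma collcp_from_or_dne :
  HA_proves_from (DNE (or_class (Pi (S j)) (Pi (S j)))) (COLLcp (Pi (S j))).
Proof.
  intros X (x & A & HA & ->). apply entails_imp_nil.
  apply (fun H => @collcp_of_or_dne _ _ j H (Var x) A HA).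
  intros B C (B' & HB & EB) (C' & HC & EC).
  apply stable_equiv with (Or B' C'); [now apply equiv_or|].
  apply HA_plus_entails. exists (Or B' C'). split; [|reflexivity].
  exists B', C'. auto.
Qed.

Lemma cd_from_collcp : HA_proves_from (COLLcp (Pi (S j))) (CD (Pi (S j)) (Pi (S j))).
Proof.
  intros X (A & B & HA & HB & ->). apply entails_imp_nil.
  apply cd_of_collcp with j; try (now apply (@cls_base _ false)).
  intros C G HC. apply HA_plus_instance. right. exists 0, C. auto.
Qed.

Lemma dml_dual_from_cd :
  HA_proves_from (CD (Pi (S j)) (Pi (S j))) (DML_dual (Sigma (S j))).
Proof.
  intros X (A & B & HA & HB & ->). apply entails_imp_nil.
  apply dml_dual_of_cd with j; [|exact HA|exact HB].
  intros C D (C' & HC & EC) (D' & HD & ED) G H.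
  apply (equiv_or EC (equiv_quant false ED)).
  assert (K : entails (HA_plus (CD (Pi (S j)) (Pi (S j))))
    (All (Or (lift C') D')) (Or C' (All D'))).
  { apply HA_plus_entails. exists C', D'. auto. }
  apply K, (equiv_quant false (equiv_or (equiv_subst shift EC) ED)). exact H.
Qed.
End Equivalences.

Theorem corollary7p6 (k : nat) (hk : 1 <= k) (P Q : scheme) :
  let principles :=
    [ plus (DML (Sigma k)) (DNE (Sigma (k - 1)));
      DML_dual (Sigma k);
      CD (Pi k) (Pi k);
      COLLcp (Pi k);
      DNE (or_class (Pi k) (Pi k)) ] in
  In P principles -> In Q principles -> equivalent_over_HA P Q.
Proof.
  destruct k as [|j]; [lia|]. replace (S j - 1) with j by lia. intros principles.
  enough (H : forall R, In R principles ->
    HA_proves_from (DML_dual (Sigma (S j))) R /\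
    HA_proves_from R (DML_dual (Sigma (S j)))).
  { intros HP HQ. destruct (H P HP), (H Q HQ).
    split; eapply HA_proves_from_trans; eassumption. }
  pose proof (@or_dne_from_dml_dual j) as H1.
  pose proof (HA_proves_from_trans H1 (@collcp_from_or_dne j)) as H2.
  pose proof (HA_proves_from_trans H2 (@cd_from_collcp j)) as H3.
  pose proof (@dml_dual_from_cd j) as K3.
  pose proof (HA_proves_from_trans (@cd_from_collcp j) K3) as K2.
  pose proof (HA_proves_from_trans (@collcp_from_or_dne j) K2) as K1.
  intros R HR. repeat (destruct HR as [<-|HR]); [..|destruct HR]; split; auto.
  - apply dml_from_dml_dual.
  - apply dml_dual_from_dml.
  - exact (HA_proves_from_trans H3 K3).
  - exact (HA_proves_from_trans H3 K3).
Qed.
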